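(* Let $q=2^e$ with $e\ge3$ odd, $\sigma=2^{\frac{e+1}{2}}$, and let $\varepsilon\in\mathbb{F}_{q^2}\setminus\mathbb{F}_q$ satisfy $\varepsilon^2+\varepsilon+\delta=0$ with $\delta\in\mathbb{F}_q\setminus\{1\}$, $\mathrm{Tr}_{q/2}(\delta)=1$. The following hold: (1) $\mathrm{Aut}(\mathcal{H}^3_\varepsilon)\cap\mathrm{PGL}_4(q^2)=E\langle\vartheta\rangle$ is a group of order $2q^3$; (2) $\mathrm{Aut}(\mathcal{H}^3_\varepsilon)$ preserves the triple $(P_\infty,\ell_\infty,\Pi_\infty)$, i.e. it fixes each of the point $P_\infty$, the line $\ell_\infty$ and the plane $\Pi_\infty$.
   Context: Points of $\mathrm{PG}(3,q^2)$ have homogeneous coordinates $(X_0,X_1,X_2,X_3)$; $\Pi_\infty$ is the plane $X_0=0$, $\ell_\infty$ is the line $X_0=X_1+X_2=0$, $P_\infty=(0,0,0,1)$; affine coordinates are $x_i=X_i/X_0$. In exponents, $\sigma$ denotes the integer $2^{(e+1)/2}$. $\mathrm{Tr}_{q/2}$ is the absolute trace of $\mathbb{F}_q$. Matrices act on row vectors of homogeneous coordinates by right multiplication. Put $\Gamma_\varepsilon(x)=[x+(x^q+x)\varepsilon]^{\sigma+2}+(x^q+x)^\sigma+(x^{2q}+x^2)\varepsilon+x^{q+1}+x^2$. The BT quasi-Hermitian variety $\mathcal{H}^3_\varepsilon$ is the set consisting of the affine points $(x_1,x_2,x_3)\in\mathbb{F}_{q^2}^3$ with $x_3^q+x_3=\Gamma_\varepsilon(x_1)+\Gamma_\varepsilon(x_2)$,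 together with the points $(0,X_1,X_2,X_3)$ with $X_1^{q+1}+X_2^{q+1}=0$. $\mathrm{Aut}(\mathcal{H}^3_\varepsilon)$ is the full automorphism (collineation) group of $\mathcal{H}^3_\varepsilon$, i.e. its setwise stabilizer in $\mathrm{P\Gamma L}_4(q^2)$. $E=\langle\tau_{\gamma_1,\gamma_2,\gamma_3}:\gamma_i\in\mathbb{F}_q\rangle$, a subgroup of $\mathrm{Aut}(\mathcal{H}^3_\varepsilon)$ of order $q^3$, where $\tau_{\gamma_1,\gamma_2,\gamma_3}\in\mathrm{PGL}_4(q^2)$ is represented by $$\begin{pmatrix}1&\gamma_1\varepsilon&\gamma_2\varepsilon&\gamma_3+(\gamma_1+\gamma_2)^\sigma\varepsilon\\0&1&0&\gamma_1+\gamma_1\varepsilon\\0&0&1&\gamma_2+\gamma_2\varepsilon\\0&0&0&1\end{pmatrix}.$$ $\vartheta\in\mathrm{PGL}_4(q^2)$ is the collineation $(x_0,x_1,x_2,x_3)\mapsto(x_0,x_2,x_1,x_3)$. *)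

(* Defs.v *)
From HB Require Import structures.
From mathcomp Require Import all_boot all_order all_algebra all_fingroup.

Set Implicit Arguments.
Unset Strict Implicit.
Unset Printing Implicit Defensive.

Import GRing.Theory.
Local Open Scope ring_scope.

Section ProjectiveSpace.

Variable F : finFieldType.

(* A point of PG(3, F) is a one-dimensional subspace of F^4, given as the set
   of its vectors (zero included). *)
Definition is_point (S : {set 'rV[F]_4}) : bool :=
  [exists v : 'rV[F]_4, (v != 0) && (S == [set a *: v | a : F])].

Record point := Point { vectors :> {set 'rV[F]_4}; pointP : is_point vectors }.

HB.instance Definition _ := [isSub for vectors].
HB.instance Definition _ := [Finite of point by <:].

Fact is_point_span (v : 'rV[F]_4) : v != 0 -> is_point [set a *: v | a : F].
Proof. by move=> nz_v; apply/existsP; exists v; rewrite nz_v eqxx. Qed.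

Definition span_point (v : 'rV[F]_4) (nz_v : v != 0) : point :=
  Point (is_point_span nz_v).

Definition is_field_aut (phi : {perm F}) : bool :=
  [forall x, forall y,
     (phi (x + y) == phi x + phi y) && (phi (x * y) == phi x * phi y)].

Record field_aut :=
  FieldAut { aut_perm :> {perm F}; field_autP : is_field_aut aut_perm }.

HB.instance Definition _ := [isSub for aut_perm].
HB.instance Definition _ := [Finite of field_aut by <:].

Fact is_field_aut1 : is_field_aut 1%g.
Proof. by apply/forallP=> x; apply/forallP=> y; rewrite !perm1 !eqxx. Qed.

Definition field_aut1 : field_aut := FieldAut is_field_aut1.

Section Collineation.

Variables (phi : field_aut) (A : {'GL_4[F]}).

Definition semilinear (v : 'rV[F]_4) : 'rV[F]_4 := map_mx phi v *m GLval A.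

Fact field_autD x y : phi (x + y) = phi x + phi y.
Proof. by case: phi => s /= /forallP/(_ x)/forallP/(_ y)/andP[/eqP]. Qed.

Fact field_autM x y : phi (x * y) = phi x * phi y.
Proof. by case: phi => s /= /forallP/(_ x)/forallP/(_ y)/andP[_ /eqP]. Qed.

Fact field_aut0 : phi 0 = 0.
Proof. by apply: (addrI (phi 0)); rewrite -field_autD !addr0. Qed.

Fact semilinear_inj : injective semilinear.
Proof.
have uA : GLval A \in unitmx by exact: GL_unitmx.
move=> u v /(can_inj (mulmxK uA)) /matrixP eq_uv; apply/matrixP=> i j.
by have := eq_uv i j; rewrite !mxE => /perm_inj.
Qed.

Fact semilinearZ a v : semilinear (a *: v) = phi a *: semilinear v.
Proof.
rewrite /semilinear scalemxAl; congr (_ *m _).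
by apply/matrixP=> i j; rewrite !mxE field_autM.
Qed.

Fact semilinear0 : semilinear 0 = 0.
Proof.
rewrite /semilinear (_ : map_mx _ 0 = 0) ?mul0mx //.
by apply/matrixP=> i j; rewrite !mxE field_aut0.
Qed.

Fact is_point_semilinear (P : point) : is_point [set semilinear v | v in P].
Proof.
case: P => S /= /existsP[v /andP[nz_v /eqP->]].
apply/existsP; exists (semilinear v); apply/andP; split.
  by apply: contraNneq nz_v => sv0; apply/eqP/semilinear_inj; rewrite semilinear0.
apply/eqP/setP=> w; apply/imsetP/imsetP.
  case=> u /imsetP[a _ ->] ->.
  by exists (phi a) => //; rewrite semilinearZ.
case=> a _ ->; exists (((aut_perm phi)^-1)%g a *: v); first by apply/imsetP; exists (((aut_perm phi)^-1)%g a).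
by rewrite semilinearZ permKV.
Qed.

Definition collineation_fun (P : point) : point := Point (is_point_semilinear P).

Fact collineation_inj : injective collineation_fun.
Proof.
move=> P Q /(congr1 val) /= eqPQ; apply: val_inj.
exact: (imset_inj semilinear_inj) eqPQ.
Qed.

Definition collineation : {perm point} := perm collineation_inj.

End Collineation.

Definition PGammaL4 : {set {perm point}} :=
  [set collineation u.1 u.2 | u : field_aut * {'GL_4[F]}].

Definition PGL4 : {set {perm point}} :=
  [set collineation field_aut1 A | A : {'GL_4[F]}].

Definition row4 (a b c d : F) : 'rV[F]_4 := \row_j [:: a; b; c; d]`_j.

Fact Pinf_neq0 : row4 0 0 0 1 != 0.
Proof. by apply/eqP=> /matrixP/(_ 0 3)/eqP; rewrite !mxE /= oner_eq0. Qed.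

Definition Pinf : point := span_point Pinf_neq0.

Definition linf : {set point} :=
  [set P : point | P \subset
     [set v : 'rV[F]_4 | (v 0 0 == 0) && (v 0 1 + v 0 2 == 0)]].

Definition Piinf : {set point} :=
  [set P : point | P \subset [set v : 'rV[F]_4 | v 0 0 == 0]].

End ProjectiveSpace.

Section BTQuasiHermitian.

Variable F : finFieldType.

(* The subfield of order q, when F has order q ^ 2. *)
Definition Fq (q : nat) : {set F} := [set x : F | x ^+ q == x].

Variables (q sigma : nat) (eps : F).

Definition Gamma (x : F) : F :=
  (x + (x ^+ q + x) * eps) ^+ (sigma + 2) + (x ^+ q + x) ^+ sigma
  + (x ^+ (2 * q) + x ^+ 2) * eps + x ^+ (q + 1) + x ^+ 2.

(* Both branches depend only on the point spanned by the nonzero vector v. *)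
Definition on_BT (v : 'rV[F]_4) : bool :=
  if v 0 0 == 0 then v 0 1 ^+ (q + 1) + v 0 2 ^+ (q + 1) == 0
  else let x i := v 0 i / v 0 0 in
       x 3 ^+ q + x 3 == Gamma (x 1) + Gamma (x 2).

Definition BT : {set point F} :=
  [set P : point F | [exists v in vectors P, (v != 0) && on_BT v]].

Definition AutBT : {set {perm point F}} := ('N_(PGammaL4 F)(BT | 'P))%g.

Definition tau_mx (g1 g2 g3 : F) : 'M[F]_4 :=
  \matrix_(i < 4)
    nth 0 [:: row4 1 (g1 * eps) (g2 * eps) (g3 + (g1 + g2) ^+ sigma * eps);
              row4 0 1          0          (g1 + g1 * eps);
              row4 0 0          1          (g2 + g2 * eps);
              row4 0 0          0          1] i.

Fact tau_mx_unit g1 g2 g3 : tau_mx g1 g2 g3 \is a GRing.unit.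
Proof.
rewrite -[_ \is a _]/(_ \in unitmx) unitmxE -det_tr det_trig; last first.
  apply/is_trig_mxP=> -[[|[|[|[|i]]]] ?] [[|[|[|[|j]]]] ?] //= _;
    by rewrite !mxE.
by rewrite big1 ?unitr1 // => -[[|[|[|[|i]]]] ?] _ //; rewrite !mxE.
Qed.

Definition tau (g1 g2 g3 : F) : {perm point F} :=
  collineation (field_aut1 F) (FinRing.Unit (tau_mx_unit g1 g2 g3)).

Definition E : {set {perm point F}} :=
  <<[set tau g.1.1 g.1.2 g.2 | g in setX (setX (Fq q) (Fq q)) (Fq q)]>>%g.

End BTQuasiHermitian.

Section Theta.

Variable F : finFieldType.

Definition theta_mx : 'M[F]_4 := tperm_mx 1 2.

Fact theta_mx_unit : theta_mx \is a GRing.unit.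
Proof. exact: unitmx_perm. Qed.

Definition theta : {perm point F} :=
  collineation (field_aut1 F) (FinRing.Unit theta_mx_unit).

Fact theta_row4 a b c d : row4 a b c d *m theta_mx = row4 a c b d.
Proof.
rewrite /theta_mx /tperm_mx -[LHS]/(_ *m perm_mx _) -(tpermV 1 2) -col_permE.
apply/rowP=> -[[|[|[|[|j]]]] lt_j] //; rewrite !mxE;
by case: tpermP => [->|->|] //= ne1 ne2; do ?[by case: ne1; apply: val_inj | by case: ne2; apply: val_inj].
Qed.

End Theta.

(* Main.v *)
Require Import Defs.
From mathcomp Require Import all_boot all_order all_algebra all_fingroup.
From mathcomp Require Import cyclic finfield ring.
Set Implicit Arguments.
Unset Strict Implicit.
Unset Printing Implicit Defensive.
Import GRing.Theory.
Local Open Scope ring_scope.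

(** Let K be the subfield of order q. The two roots of X^2 + X + delta are
    conjugate over K, so eps ^+ q = eps + 1 and every x in F is uniquely
    re x + im x * eps with re x and im x in K. In these coordinates the
    messy function Gamma is the function of the Suzuki-Tits ovoid,
    re x ^ (sigma + 2) + re x * im x + im x ^ sigma ([GammaE]), so the affine
    part of the variety is im x3 = Gamma x1 + Gamma x2.

    Along a Baer subline p + k w, where k runs over K, both sides of this
    equation are combinations of 1, k, k^2, k^sigma and k^(sigma + 2). These
    exponents are distinct and smaller than q - 1, so a subline contained in
    the variety yields five equations between the coordinates of p and w
    ([Fq_poly_eq0], [pencil_coefs]). Every step below reads off some of these
    coefficients; the top one is decisive because x |-> x^(sigma + 2) is
    injective on K ([exps2_inj]).

    The flag. P_infty is the only point P such that every point of the variety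
    can be joined to P by a Baer subline whose points other than P all lie on
    the variety ([sublines_Pinf], [sublines_throughP]). A semilinear map
    permutes Baer sublines because field automorphisms preserve K; hence every
    automorphism fixes P_infty. A vector v lies in the plane at infinity if and
    only if adding multiples of (0,0,0,1) to v never changes whether v is on
    the variety, so that plane is fixed as well. The variety contains the line
    joining (1,0,0,0) to (0,1,1,0), and its image is again an affine line in
    the variety. If such a line has direction (0,w1,w2,w3), the top coefficient
    gives re (d w1) = re (d w2) for all d, so w1 = w2: its point at infinity
    lies on l_infty, which is therefore fixed ([aut_mx_linf]).

    The linear part. By the above, the matrix of a linear automorphism,
    normalised to have top left entry 1, is determined by an affine map in
    (x1, x2) that multiplies Gamma x1 + Gamma x2 by a constant c up to the
    contribution of x3. The top coefficients say that its linear part is a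
    similarity of re x1 ^ (sigma + 2) + re x2 ^ (sigma + 2), and such a
    similarity multiplies both coordinates by one r in K, up to exchanging them
    ([tits_form_similarity]). The lower coefficients force r = 1 and leave
    exactly the entries of tau ([tau_parameters]). So the linear automorphisms
    are the tau's and the theta tau's. The tau's form a group of order q^3 by
    the product formula [tauM], and theta normalises it by exchanging the first
    two parameters. *)

(** * Points and collineations in coordinates *)

Section Collineations.

Variable F : finFieldType.
Implicit Types (P Q : point F) (v w : 'rV[F]_4) (phi : field_aut F) (A : {'GL_4[F]}).

Lemma point_vector P : exists2 v, v != 0 & v \in vectors P.
Proof.
have /existsP[v /andP[v0 /eqP P_v]] := pointP P.
by exists v => //; rewrite P_v; apply/imsetP; exists 1; rewrite ?scale1r.
Qed.

Lemma pointE P v : v != 0 -> v \in vectors P -> vectors P = [set a *: v | a : F].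
Proof.
have /existsP[w /andP[w0 /eqP->]] := pointP P.
move=> v0 /imsetP[b _ v_bw]; have b0 : b != 0.
  by apply: contraNneq v0 => b0; rewrite v_bw b0 scale0r.
apply/setP=> u; apply/imsetP/imsetP=> -[a _ ->].
  by exists (a / b) => //; rewrite v_bw scalerA divfK.
by exists (a * b) => //; rewrite v_bw scalerA.
Qed.

Lemma eq_point P Q v : v != 0 -> v \in vectors P -> v \in vectors Q -> P = Q.
Proof. by move=> v0 vP vQ; apply: val_inj; rewrite /= (pointE v0 vP) (pointE v0 vQ). Qed.

Lemma pointZ P v a : v \in vectors P -> a *: v \in vectors P.
Proof.
have /existsP[w /andP[w0 /eqP->]] := pointP P.
by case/imsetP=> b _ ->; rewrite scalerA; apply: imset_f.
Qed.

Lemma mem_span_point v (v0 : v != 0) : v \in vectors (span_point v0).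
Proof. by apply/imsetP; exists 1; rewrite ?scale1r. Qed.

Lemma mem_collineation phi A P v :
  v \in vectors P -> Defs.semilinear phi A v \in vectors (collineation phi A P).
Proof. by move=> vP; rewrite permE; apply: imset_f. Qed.

Lemma collineationP phi A P w :
  w \in vectors (collineation phi A P) -> exists2 v, v \in vectors P & w = Defs.semilinear phi A v.
Proof. by rewrite permE => /imsetP. Qed.

Lemma semilinear_eq0 phi A v : (Defs.semilinear phi A v == 0) = (v == 0).
Proof. by rewrite -[RHS](inj_eq (@semilinear_inj _ phi A)) semilinear0. Qed.

(** The image of a point is determined by the image of any one of its nonzero
    vectors, so collineations can be computed on representatives. *)
Lemma collineation_mem_eq phi A P Q v :
  v != 0 -> v \in vectors P -> Defs.semilinear phi A v \in vectors Q -> collineation phi A P = Q.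
Proof.
move=> v0 vP fvQ; apply: (@eq_point _ _ (Defs.semilinear phi A v)) => //.
  by rewrite semilinear_eq0.
exact: mem_collineation.
Qed.

(** Proportional semilinear maps induce the same collineation; this is what
    allows matrices to be normalised. *)
Lemma eq_collineation c phi psi A B : c != 0 ->
  (forall v, Defs.semilinear phi A v = c *: Defs.semilinear psi B v) ->
  collineation phi A = collineation psi B.
Proof.
move=> c0 eq_AB; apply/permP=> P; have [v v0 vP] := point_vector P.
by apply: (collineation_mem_eq v0 vP); rewrite eq_AB pointZ ?mem_collineation.
Qed.

Lemma semilinear_surj phi A w : exists v, Defs.semilinear phi A v = w.
Proof. by have [g _ gK] := injF_bij (@semilinear_inj _ phi A); exists (g w). Qed.

Lemma semilinearD phi A v w :
  Defs.semilinear phi A (v + w) = Defs.semilinear phi A v + Defs.semilinear phi A w.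
Proof.
rewrite /Defs.semilinear -mulmxDl; congr (_ *m _).
by apply/matrixP=> i j; rewrite !mxE field_autD.
Qed.

Lemma field_aut1E phi : phi 1 = 1.
Proof.
have phi1_neq0 : phi 1 != 0.
  by rewrite -(field_aut0 phi) (inj_eq perm_inj) oner_eq0.
by apply: (mulfI phi1_neq0); rewrite -field_autM !mulr1.
Qed.

Lemma field_autX phi x n : phi (x ^+ n) = phi x ^+ n.
Proof. by elim: n => [|n IHn]; rewrite ?expr0 ?field_aut1E // !exprS field_autM IHn. Qed.

(** The subfield of order q is the set of fixed points of a power map, and power
    maps commute with field automorphisms. *)
Lemma field_aut_Fq phi q x : (phi x \in Fq F q) = (x \in Fq F q).
Proof. by rewrite !inE -field_autX (inj_eq perm_inj). Qed.

Lemma mulmx4E v (M : 'M[F]_4) j : (v *m M) 0 j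
  = v 0 0 * M 0 j + v 0 1 * M 1 j + v 0 2 * M 2 j + v 0 3 * M 3 j.
Proof.
rewrite mxE !big_ord_recl big_ord0 addr0 !addrA.
have [e1 e2 e3] : [/\ lift ord0 ord0 = 1 :> 'I_4, lift ord0 (lift ord0 ord0) = 2 :> 'I_4
   & lift ord0 (lift ord0 (lift ord0 ord0)) = 3 :> 'I_4] by split; apply: val_inj.
by rewrite e1 e2 e3.
Qed.

Lemma semilinearE phi A v j : (Defs.semilinear phi A v) 0 j
  = phi (v 0 0) * GLval A 0 j + phi (v 0 1) * GLval A 1 j
    + phi (v 0 2) * GLval A 2 j + phi (v 0 3) * GLval A 3 j.
Proof. by rewrite /Defs.semilinear mulmx4E !mxE. Qed.

Lemma linear_semilinearE A v : Defs.semilinear (field_aut1 F) A v = v *m GLval A.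
Proof.
by rewrite /Defs.semilinear; congr (_ *m _); apply/matrixP=> i j; rewrite mxE perm1.
Qed.

Lemma linear_collineationM A B :
  collineation (field_aut1 F) (A * B)%g
  = (collineation (field_aut1 F) A * collineation (field_aut1 F) B)%g.
Proof.
apply/permP=> P; rewrite permM; have [v v0 vP] := point_vector P.
apply: (collineation_mem_eq v0 vP).
have -> : Defs.semilinear (field_aut1 F) (A * B)%g v
   = Defs.semilinear (field_aut1 F) B (Defs.semilinear (field_aut1 F) A v).
  by rewrite !linear_semilinearE mulmxA.
by rewrite !mem_collineation.
Qed.

Lemma row4E (a b c d : F) :
  (row4 a b c d 0 0 = a) * (row4 a b c d 0 1 = b) *
  (row4 a b c d 0 2 = c) * (row4 a b c d 0 3 = d).
Proof. by rewrite !mxE. Qed.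

Lemma row4_eta v : v = row4 (v 0 0) (v 0 1) (v 0 2) (v 0 3).
Proof.
by apply/rowP=> -[[|[|[|[|j]]]] lt_j] //; rewrite !mxE /=; congr (v _ _); apply: val_inj.
Qed.

Lemma row4D (a b c d a' b' c' d' : F) :
  row4 a b c d + row4 a' b' c' d' = row4 (a + a') (b + b') (c + c') (d + d').
Proof. by rewrite [LHS]row4_eta !mxE. Qed.

Lemma row4Z (k a b c d : F) : k *: row4 a b c d = row4 (k * a) (k * b) (k * c) (k * d).
Proof. by rewrite [LHS]row4_eta !mxE. Qed.

Lemma row4_affine v : v 0 0 != 0 ->
  v = v 0 0 *: row4 1 (v 0 1 / v 0 0) (v 0 2 / v 0 0) (v 0 3 / v 0 0).
Proof.
by move=> v0; rewrite row4Z {1}[v]row4_eta mulr1 ![v 0 0 * _]mulrC !divfK.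
Qed.

End Collineations.

(** * The quadratic extension in coordinates *)

Section BTGeometry.

Variables (e q sigma : nat) (F : finFieldType) (eps delta : F).
Hypotheses (e_ge3 : (3 <= e)%N) (e_odd : odd e).
Hypotheses (q_def : q = (2 ^ e)%N) (sigma_def : sigma = (2 ^ ((e + 1) %/ 2))%N).
Hypothesis cardF : #|F| = (q ^ 2)%N.
Hypothesis eps_notin : eps \notin Fq F q.
Hypothesis eps_eq : eps ^+ 2 + eps + delta = 0.
Hypotheses (delta_in : delta \in Fq F q) (delta_neq1 : delta != 1).

Local Notation K := (Fq F q).
Local Notation Gam := (Gamma q sigma eps).
Local Notation onH := (on_BT q sigma eps).

(** In exponents modulo q - 1 this says that sigma is a square root of 2. *)
Lemma sigma_sq : (sigma * sigma = q * 2)%N.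
Proof.
rewrite sigma_def q_def -expnD -expnSr; congr (2 ^ _)%N.
by rewrite addnn -muln2 divnK ?addn1 // dvdn2 /= e_odd.
Qed.

Lemma sigma_ge4 : (4 <= sigma)%N.
Proof.
rewrite sigma_def -[4%N]/(2 ^ 2)%N leq_exp2l // -[2%N]/(4 %/ 2)%N.
by apply: leq_div2r; rewrite addn1 ltnS.
Qed.

(** This bound keeps the exponents 1, 2, sigma, sigma + 2 below the number q - 1
    of nonzero elements of the subfield. *)
Lemma sigma_lt_q : (sigma + 3 < q)%N.
Proof.
have s4 := sigma_ge4.
have : (sigma * 4 <= q * 2)%N by rewrite -sigma_sq leq_mul2l s4 orbT.
rewrite -[4%N]/(2 * 2)%N mulnA leq_pmul2r //; apply: leq_trans.
by rewrite muln2 -addnn -addnS leq_add2l.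
Qed.

Lemma char2 : 2%N \in [pchar F].
Proof. by apply: (@card_finPcharP _ _ (e * 2)) => //; rewrite cardF q_def -expnM. Qed.

Lemma two0 : 2%:R = 0 :> F.
Proof. exact: pcharf0 char2. Qed.

Lemma three1 : 3%:R = 1 :> F.
Proof. by rewrite (natrD F 2 1) two0 add0r. Qed.

Lemma four0 : 4%:R = 0 :> F.
Proof. by rewrite (natrM F 2 2) two0 mul0r. Qed.

Lemma addxx (x : F) : x + x = 0.
Proof. exact: addrr_pchar2 char2 x. Qed.

Lemma addK2 (x y : F) : x + y + y = x.
Proof. by rewrite -addrA addxx addr0. Qed.

Lemma add_eq0 (x y : F) : (x + y == 0) = (x == y).
Proof. by rewrite addr_eq0 (oppr_pchar2 char2). Qed.

Lemma expD_pow2 (x y : F) k : (x + y) ^+ (2 ^ k) = x ^+ (2 ^ k) + y ^+ (2 ^ k).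
Proof.
apply: exprDn_pchar; apply/pnatP; first by rewrite expn_gt0.
by move=> p p_pr; rewrite Euclid_dvdX // dvdn_prime2 // => /andP[/eqP-> _]; exact: char2.
Qed.

Lemma expDq (x y : F) : (x + y) ^+ q = x ^+ q + y ^+ q.
Proof. by rewrite q_def expD_pow2. Qed.

Lemma expDs (x y : F) : (x + y) ^+ sigma = x ^+ sigma + y ^+ sigma.
Proof. by rewrite sigma_def expD_pow2. Qed.

Lemma expD2 (x y : F) : (x + y) ^+ 2 = x ^+ 2 + y ^+ 2.
Proof. exact: (expD_pow2 x y 1). Qed.

Lemma q_gt0 : (0 < q)%N. Proof. by rewrite q_def expn_gt0. Qed.
Lemma sigma_gt0 : (0 < sigma)%N. Proof. by rewrite sigma_def expn_gt0. Qed.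

Lemma exps_inj : injective (fun x : F => x ^+ sigma).
Proof.
move=> x y /= /eqP; rewrite -add_eq0 -expDs expf_eq0 sigma_gt0 add_eq0.
by move/eqP.
Qed.

Lemma exp2_inj : injective (fun x : F => x ^+ 2).
Proof. by move=> x y /= /eqP; rewrite -add_eq0 -expD2 expf_eq0 add_eq0 => /eqP. Qed.

(** The order of F is q^2. *)
Lemma expqq (x : F) : (x ^+ q) ^+ q = x.
Proof. by rewrite -exprM mulnn -cardF expf_card. Qed.

Lemma FqP (x : F) : reflect (x ^+ q = x) (x \in K).
Proof. by rewrite inE; apply: eqP. Qed.

Lemma Fq0 : 0 \in K.
Proof. by apply/FqP; rewrite expr0n eqn0Ngt q_gt0. Qed.

Lemma Fq1 : 1 \in K.
Proof. by apply/FqP; rewrite expr1n. Qed.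

Lemma FqD x y : x \in K -> y \in K -> x + y \in K.
Proof. by move=> /FqP x_K /FqP y_K; apply/FqP; rewrite expDq x_K y_K. Qed.

Lemma FqM x y : x \in K -> y \in K -> x * y \in K.
Proof. by move=> /FqP x_K /FqP y_K; apply/FqP; rewrite exprMn x_K y_K. Qed.

Lemma FqX x n : x \in K -> x ^+ n \in K.
Proof. by move=> /FqP x_K; apply/FqP; rewrite exprAC x_K. Qed.

Lemma FqV x : x \in K -> x^-1 \in K.
Proof. by move=> /FqP x_K; apply/FqP; rewrite exprVn x_K. Qed.

Lemma epsE : eps ^+ 2 = eps + delta.
Proof. by apply/eqP; rewrite -add_eq0 addrA eps_eq. Qed.

(** Coefficients are reduced modulo 2 by 2 = 0, 3 = 1 and 4 = 0; each equation
    acts only on coefficients equal to its left-hand side. *)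
Ltac char2_ring := ring: epsE two0 three1 four0.

(** The conjugate of eps is a root of the same quadratic polynomial, and it
    differs from eps because eps is not in the subfield. *)
Lemma epsq : eps ^+ q = eps + 1.
Proof.
have /FqP delta_q := delta_in.
have epsqE : (eps ^+ q) ^+ 2 = eps ^+ q + delta.
  by rewrite exprAC epsE expDq delta_q.
have : (eps ^+ q + eps) * (eps ^+ q + eps + 1) = 0.
  by ring: epsE epsqE two0 four0.
move/eqP; rewrite mulf_eq0 => /orP[|].
  by rewrite add_eq0 => /eqP/FqP; rewrite (negPf eps_notin).
by rewrite -addrA add_eq0 => /eqP.
Qed.

(** The coordinates of x in the basis 1, eps of F over the subfield: im is the
    relative trace, for which im 1 = 0 and im eps = 1. *)
Definition im (x : F) := x ^+ q + x.
Definition re (x : F) := x + im x * eps.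

Lemma im_Fq x : im x \in K.
Proof. by apply/FqP; rewrite /im expDq expqq addrC. Qed.

Lemma re_Fq x : re x \in K.
Proof.
apply/FqP; rewrite /re expDq exprMn epsq (FqP _ (im_Fq x)) /im.
by char2_ring.
Qed.

Lemma reimE x : x = re x + im x * eps.
Proof. by rewrite /re addK2. Qed.

Lemma imD x y : im (x + y) = im x + im y.
Proof. by rewrite /im expDq; ring. Qed.

Lemma imZ k x : k \in K -> im (k * x) = k * im x.
Proof. by move=> /FqP k_K; rewrite /im exprMn k_K mulrDr. Qed.

Lemma im_eq0 x : (im x == 0) = (x \in K).
Proof. by rewrite /im add_eq0 inE. Qed.

Lemma im0K x : x \in K -> im x = 0.
Proof. by move=> x_K; apply/eqP; rewrite im_eq0. Qed.

Lemma im_eps : im eps = 1.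
Proof. by rewrite /im epsq; ring: two0. Qed.

Lemma reD x y : re (x + y) = re x + re y.
Proof. by rewrite /re imD; ring. Qed.

Lemma reZ k x : k \in K -> re (k * x) = k * re x.
Proof. by move=> k_K; rewrite /re imZ //; ring. Qed.

Lemma re_id x : x \in K -> re x = x.
Proof. by move=> x_K; rewrite /re im0K // mul0r addr0. Qed.

Lemma re_eps : re eps = 0.
Proof. by rewrite /re im_eps mul1r addxx. Qed.

Lemma im_coords a b : a \in K -> b \in K -> im (a + b * eps) = b.
Proof. by move=> a_K b_K; rewrite imD im0K // imZ // im_eps mulr1 add0r. Qed.

Lemma re_coords a b : a \in K -> b \in K -> re (a + b * eps) = a.
Proof. by move=> a_K b_K; rewrite reD re_id // reZ // re_eps mulr0 addr0. Qed.

Lemma card_Fq : #|K| = q.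
Proof.
have : #|[set: F]| = #|setX K K|.
  rewrite -(card_in_imset (f := fun x => (re x, im x))).
    apply: eq_card => -[a b]; rewrite in_setX; apply/imsetP/andP => /=.
      by case=> x _ [-> ->]; rewrite re_Fq im_Fq.
    case=> a_K b_K; exists (a + b * eps) => //.
    by rewrite re_coords // im_coords.
  by move=> x y _ _ [re_xy im_xy]; rewrite [x]reimE [y]reimE re_xy im_xy.
by rewrite cardsT cardF cardsX mulnn => /eqP; rewrite eqn_exp2r // => /eqP.
Qed.

(** The bilinear form re (x * y) is nondegenerate. *)
Lemma re_mul_eq0 m : (forall x, re (m * x) = 0) -> m = 0.
Proof.
move=> re_m; apply/eqP/negPn/negP=> m_neq0.
by have /eqP := re_m m^-1; rewrite divff // re_id ?Fq1 // oner_eq0.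
Qed.

(** The bilinear form im (x * y) is nondegenerate. *)
Lemma im_mul_eq0 m : (forall x, im (m * x) = 0) -> m = 0.
Proof.
move=> im_m; apply/eqP/negPn/negP=> m_neq0.
by have /eqP := im_m (m^-1 * eps); rewrite mulVKf // im_eps oner_eq0.
Qed.

(** Since eps + eps^2 = delta lies in the subfield, 1 + eps is the element that
    represents the linear form re through im. This is where the entries g + g *
    eps of the matrix of tau come from. *)
Lemma im_mul_1eps x : im ((1 + eps) * x) = re x.
Proof.
rewrite {1}[x]reimE.
have -> : (1 + eps) * (re x + im x * eps)
          = re x + delta * im x + re x * eps by char2_ring.
apply: im_coords; last exact: re_Fq.
by apply: FqD; [exact: re_Fq | apply: FqM delta_in (im_Fq x)].
Qed.

(** * Pencils of Baer sublines *)

(** Gamma is the function of the Suzuki-Tits ovoid: x ^+ q = x + im x turns x ^+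
    (q + 1) + x ^+ 2 into x * im x, whose part outside the subfield cancels the
    term im x ^+ 2 * eps. *)
Lemma GammaE x : Gam x = re x ^+ (sigma + 2) + re x * im x + im x ^+ sigma.
Proof.
rewrite /Gamma -/(im x) -/(re x).
have -> : x ^+ (2 * q) + x ^+ 2 = im x ^+ 2 by rewrite /im expD2 mulnC exprM.
have -> : x ^+ (q + 1) = (x + im x) * x.
  by rewrite exprD expr1 /im addrCA addxx addr0.
move: (re x) (im x) (reimE x) => a b ->; rewrite exprD; by char2_ring.
Qed.

Lemma Gamma_Fq x : Gam x \in K.
Proof. by rewrite GammaE !FqD ?FqM ?FqX ?re_Fq ?im_Fq. Qed.

Lemma Gamma0 : Gam 0 = 0.
Proof.
by rewrite GammaE re_id ?Fq0 // im0K ?Fq0 // !expr0n addn2 /= (gtn_eqF sigma_gt0) mulr0 !addr0.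
Qed.

(** The map x |-> x^(sigma + 2) is the product of two additive maps, so its
    expansion along a subline has the mixed exponents 2 and sigma only. *)
Lemma GammaD_pencil p w k : k \in K ->
  Gam (p + k * w) = Gam p + (re p * im w + im p * re w) * k
    + (re p ^+ sigma * re w ^+ 2 + re w * im w) * k ^+ 2
    + (re p ^+ 2 * re w ^+ sigma + im w ^+ sigma) * k ^+ sigma
    + re w ^+ (sigma + 2) * k ^+ (sigma + 2).
Proof.
move=> k_K; rewrite !GammaE reD imD reZ // imZ //.
move: (re p) (im p) (re w) (im w) => a b c d.
rewrite !exprD !expDs !expD2 !exprMn; by char2_ring.
Qed.

(** The polynomial has size at most sigma + 3, while its roots include the q - 1
    nonzero elements of the subfield. Leaving out k = 0 makes the lemma
    applicable after the substitution of 1/k for k. *)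
Lemma Fq_poly_eq0 (c0 c1 c2 c3 c4 : F) :
  (forall k, k \in K -> k != 0 ->
     c0 + c1 * k + c2 * k ^+ 2 + c3 * k ^+ sigma + c4 * k ^+ (sigma + 2) = 0) ->
  [/\ c0 = 0, c1 = 0, c2 = 0, c3 = 0 & c4 = 0].
Proof.
move=> vanish; pose p := c0%:P + c1 *: 'X + c2 *: 'X^2 + c3 *: 'X^sigma
                         + c4 *: 'X^(sigma + 2).
have s4 := sigma_ge4.
have coefp i : p`_i = c0 *+ (i == 0) + c1 *+ (i == 1) + c2 *+ (i == 2)
                      + c3 *+ (i == sigma) + c4 *+ (i == sigma + 2)%N.
  by rewrite !coefD coefC !coefZ coefX !coefXn !mulr_natr; case: (i == 0).
have szp : (size p <= sigma + 3)%N.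
  apply/leq_sizeP => i lt_i; have lt_s : (sigma + 2 < i)%N by rewrite -addnS.
  have lt_i2 : (2 < i)%N by apply: leq_ltn_trans lt_s; rewrite leq_addl.
  have lt_is : (sigma < i)%N by apply: leq_ltn_trans lt_s; rewrite leq_addr.
  rewrite coefp (gtn_eqF lt_s) (gtn_eqF lt_is) (gtn_eqF lt_i2).
  by rewrite !gtn_eqF ?mulr0n ?addr0 //; apply: leq_trans lt_i2.
have cardK0 : #|K :\ 0| = q.-1.
  by apply: succn_inj; rewrite (ltn_predK sigma_lt_q) -[RHS]card_Fq (cardsD1 0 K) Fq0.
have p0 : p = 0.
  apply: contraTeq szp => p_neq0; rewrite -ltnNge.
  have lt_q : (sigma + 3 <= size (enum (K :\ 0%R)))%N.
    by rewrite -cardE cardK0 -ltnS (ltn_predK sigma_lt_q) sigma_lt_q.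
  apply: (leq_ltn_trans lt_q); apply: max_poly_roots p_neq0 _ (enum_uniq _).
  apply/allP=> k; rewrite mem_enum in_setD1 => /andP[k0 k_K].
  by rewrite rootE !(hornerD, hornerZ, hornerC, hornerX, hornerXn) vanish.
have coef0E i : p`_i = 0 by rewrite p0 coef0.
have lt_s : (2 < sigma)%N by apply: leq_trans s4.
have lt_s2 : (sigma < sigma + 2)%N by rewrite addn2.
have lt_2 := ltn_trans lt_s lt_s2.
have [s1 s0] := (ltn_trans (isT : 1 < 2)%N lt_s, ltn_trans (isT : 0 < 2)%N lt_s).
have [t1 t0] := (ltn_trans (isT : 1 < 2)%N lt_2, ltn_trans (isT : 0 < 2)%N lt_2).
have neqs := (ltn_eqF lt_s, gtn_eqF lt_s, ltn_eqF lt_s2, gtn_eqF lt_s2,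
  ltn_eqF lt_2, gtn_eqF lt_2, ltn_eqF s1, gtn_eqF s1, ltn_eqF s0, gtn_eqF s0,
  ltn_eqF t1, gtn_eqF t1, ltn_eqF t0, gtn_eqF t0).
by split; [move: (coef0E 0%N)|move: (coef0E 1%N)|move: (coef0E 2%N)
       |move: (coef0E sigma)|move: (coef0E (sigma + 2)%N)];
  rewrite coefp !neqs ?eqxx /= ?mulr0n ?mulr1n ?addr0 ?add0r.
Qed.

Lemma GammaZ x k : k \in K ->
  Gam (k * x) = re x * im x * k ^+ 2 + im x ^+ sigma * k ^+ sigma
                + re x ^+ (sigma + 2) * k ^+ (sigma + 2).
Proof.
by move=> k_K; rewrite GammaE reZ // imZ // !exprD !exprMn; ring.
Qed.

(** The term with c is present for comparing the equation of the variety at a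
    point (x1, x2) with the equation at its image. *)
Lemma pencil_coefs c p1 p2 p3 w1 w2 w3 x1 x2 :
  (forall k, k \in K -> k != 0 ->
     im (p3 + k * w3) + c * (Gam (k * x1) + Gam (k * x2))
     = Gam (p1 + k * w1) + Gam (p2 + k * w2)) ->
  [/\ im p3 = Gam p1 + Gam p2,
      im w3 = re p1 * im w1 + im p1 * re w1 + (re p2 * im w2 + im p2 * re w2),
      c * (re x1 * im x1 + re x2 * im x2)
        = re p1 ^+ sigma * re w1 ^+ 2 + re w1 * im w1
          + (re p2 ^+ sigma * re w2 ^+ 2 + re w2 * im w2),
      c * (im x1 ^+ sigma + im x2 ^+ sigma)
        = re p1 ^+ 2 * re w1 ^+ sigma + im w1 ^+ sigma
          + (re p2 ^+ 2 * re w2 ^+ sigma + im w2 ^+ sigma)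
    & c * (re x1 ^+ (sigma + 2) + re x2 ^+ (sigma + 2))
        = re w1 ^+ (sigma + 2) + re w2 ^+ (sigma + 2)].
Proof.
move=> on_pencil.
have [|? ? ? ? ?] := @Fq_poly_eq0
  (im p3 + (Gam p1 + Gam p2))
  (im w3 + (re p1 * im w1 + im p1 * re w1 + (re p2 * im w2 + im p2 * re w2)))
  (c * (re x1 * im x1 + re x2 * im x2) +
    (re p1 ^+ sigma * re w1 ^+ 2 + re w1 * im w1
          + (re p2 ^+ sigma * re w2 ^+ 2 + re w2 * im w2)))
  (c * (im x1 ^+ sigma + im x2 ^+ sigma) +
    (re p1 ^+ 2 * re w1 ^+ sigma + im w1 ^+ sigma
          + (re p2 ^+ 2 * re w2 ^+ sigma + im w2 ^+ sigma)))
  (c * (re x1 ^+ (sigma + 2) + re x2 ^+ (sigma + 2)) +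
    (re w1 ^+ (sigma + 2) + re w2 ^+ (sigma + 2))).
  move=> k k_K k0; have /eqP := on_pencil k k_K k0; rewrite -add_eq0 => /eqP <-.
  rewrite imD imZ // !GammaD_pencil // !GammaZ //; ring.
by split; apply/eqP; rewrite -add_eq0; apply/eqP.
Qed.

(** With c = 0 this concerns Baer sublines contained in the affine part. *)
Lemma pencil_coefs0 p1 p2 p3 w1 w2 w3 :
  (forall k, k \in K -> k != 0 ->
     im (p3 + k * w3) = Gam (p1 + k * w1) + Gam (p2 + k * w2)) ->
  [/\ im w3 = re p1 * im w1 + im p1 * re w1 + (re p2 * im w2 + im p2 * re w2),
      re p1 ^+ sigma * re w1 ^+ 2 + re w1 * im w1
        = re p2 ^+ sigma * re w2 ^+ 2 + re w2 * im w2,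
      re p1 ^+ 2 * re w1 ^+ sigma + im w1 ^+ sigma
        = re p2 ^+ 2 * re w2 ^+ sigma + im w2 ^+ sigma
    & re w1 ^+ (sigma + 2) = re w2 ^+ (sigma + 2)].
Proof.
move=> on_pencil; have [|_ -> c2 c3 c4] := @pencil_coefs 0 p1 p2 p3 w1 w2 w3 0 0.
  by move=> k k_K k0; rewrite mul0r addr0 on_pencil.
by split=> //; apply/eqP; rewrite -add_eq0 -?c2 -?c3 -?c4 mul0r.
Qed.

Lemma Fq_sigma_sq x : x \in K -> (x ^+ sigma) ^+ sigma = x ^+ 2.
Proof. by move=> /FqP x_K; rewrite -exprM sigma_sq exprM x_K. Qed.

(** If x is in the subfield and x^(sigma + 2) = 1, then raising to the power
    sigma gives (x^(sigma + 1))^2 = 1, so x^(sigma + 1) = 1, and the quotient of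
    the two equations is x = 1. *)
Lemma exps2_inj : {in K &, injective (fun x : F => x ^+ (sigma + 2))}.
Proof.
have unity x : x \in K -> x ^+ (sigma + 2) = 1 -> x = 1.
  move=> x_K; rewrite exprD => x1.
  have : x * x ^+ sigma = 1.
    apply: exp2_inj; rewrite /= expr1n; transitivity ((x ^+ sigma * x ^+ 2) ^+ sigma).
      by rewrite !exprMn Fq_sigma_sq // exprAC.
    by rewrite x1 expr1n.
  by move=> xs1; rewrite -x1 -{1}[x]mulr1 -xs1; ring.
move=> x y x_K y_K /= eq_xy; have [y0|y0] := eqVneq y 0.
  move: eq_xy; rewrite y0 expr0n addn2 /= => /eqP.
  by rewrite expf_eq0 => /eqP.
have := unity (x / y) (FqM x_K (FqV y_K)); rewrite exprMn exprVn eq_xy divff ?expf_neq0 //.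
by move=> /(_ erefl) /(canRL (divfK y0)); rewrite mul1r.
Qed.

(** * A projective characterisation of the point at infinity *)

Lemma onH_inf a b c : onH (row4 0 a b c) = (a ^+ (q + 1) == b ^+ (q + 1)).
Proof. by rewrite /on_BT !row4E eqxx add_eq0. Qed.

Lemma onH_aff a b c : onH (row4 1 a b c) = (im c == Gam a + Gam b).
Proof. by rewrite /on_BT !row4E oner_eq0 !divr1. Qed.

Lemma onHZ c v : c != 0 -> onH (c *: v) = onH v.
Proof.
move=> c0; rewrite /on_BT !mxE mulf_eq0 (negPf c0) /=; case: ifP => _.
  by rewrite !exprMn -mulrDr mulf_eq0 expf_eq0 (negPf c0) andbF.
have cK i : (c * v 0 i) / (c * v 0 0) = v 0 i / v 0 0.
  by rewrite -mulf_div divff // mul1r.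
by rewrite !cK.
Qed.

(** As d varies, the sets of u + (k * d) *: w with k in K are the Baer sublines
    through the points spanned by u and w, without the latter; the choice of d
    depends on u. *)
Definition sublines_through (w : 'rV[F]_4) :=
  forall u, onH u -> exists2 d, d != 0 & forall k, k \in K -> onH (u + (k * d) *: w).

(** If u is affine, d is chosen so that k * d adds k to the normalised x3, which
    does not change im x3; if u is at infinity, x3 does not matter at all. *)
Lemma sublines_Pinf a : a != 0 -> sublines_through (row4 0 0 0 a).
Proof.
move=> a0 u onH_u; have [u0|u0] := eqVneq (u 0 0) 0.
  exists 1; rewrite ?oner_neq0 // => k k_K; move: onH_u.
  by rewrite [u]row4_eta u0 row4Z row4D !mulr0 !addr0 !onH_inf.
exists (u 0 0 / a); first by rewrite mulf_neq0 ?invr_eq0.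
move=> k k_K; move: onH_u; rewrite [u]row4_affine // onHZ //.
set x := u 0 0 in u0 *; set y1 := u 0 1 / x; set y2 := u 0 2 / x; set y3 := u 0 3 / x.
rewrite !mxE /= mulr1.
have -> : x *: row4 1 y1 y2 y3 + (k * (x / a)) *: row4 0 0 0 a = x *: row4 1 y1 y2 (y3 + k).
  rewrite !row4Z row4D !mulr0 !addr0 mulrDr; congr (row4 _ _ _ (_ + _)).
  by field.
by rewrite onHZ // !onH_aff imD (im0K k_K) addr0.
Qed.

(** For w affine, consider sublines to the points (0, eps, eps + 1, m) at
    infinity. Exchanging the ends of the subline turns it into a pencil based at
    w with direction D (0, eps, eps + 1, m). The top coefficient forces re D =
    0, so D is a multiple of eps by an element of the subfield. Then the linear
    coefficient prescribes im (eps * m) independently of m. *)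
Lemma sublines_affine_absurd (w : 'rV[F]_4) : w 0 0 != 0 -> ~ sublines_through w.
Proof.
move=> w0 lines_w; set w1 := w 0 1 / w 0 0; set w2 := w 0 2 / w 0 0; set w3 := w 0 3 / w 0 0.
pose X := re w1 * im (eps * eps) + im w1 * re (eps * eps)
  + (re w2 * im (eps * (eps + 1)) + im w2 * re (eps * (eps + 1))).
have im_X m : im (eps * m) = X.
  (* The norms of eps and eps + 1 agree, as these elements are conjugate. *)
  have onH_u : onH (row4 0 eps (eps + 1) m).
    by rewrite onH_inf !exprD !expr1 expDq expr1n epsq addK2 mulrC.
  have [d d0 on_line] := lines_w _ onH_u.
  (* Dividing u + (d / k) * w by its first coordinate gives a pencil in k with
     direction D * u. *)
  pose D := (d * w 0 0)^-1.
  have D0 : D != 0 by rewrite invr_eq0 mulf_neq0.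
  have [|c1 _ _ c4] := @pencil_coefs0 w1 w2 w3 (D * eps) (D * (eps + 1)) (D * m).
    move=> k k_K k0; have := on_line _ (FqV k_K).
    have -> : row4 0 eps (eps + 1) m + (k^-1 * d) *: w
        = (k^-1 * d * w 0 0) *: row4 1 (w1 + k * (D * eps))
            (w2 + k * (D * (eps + 1))) (w3 + k * (D * m)).
      rewrite [in LHS](row4_affine w0) -/w1 -/w2 -/w3 scalerA !row4Z row4D.
      have kd x y : x + k^-1 * d * w 0 0 * y = k^-1 * d * w 0 0 * (y + k * (D * x)).
        by rewrite /D; field; rewrite w0 d0 k0.
      by rewrite !kd !mulr0 addr0.
    by rewrite onHZ ?mulf_neq0 ?invr_eq0 // onH_aff => /eqP.
  have reD0 : re D = 0.
    have := exps2_inj (re_Fq _) (re_Fq _) c4; rewrite mulrDr mulr1 reD => /eqP.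
    by rewrite -subr_eq0 opprD addNKr oppr_eq0 => /eqP.
  have DE : D = im D * eps by rewrite {1}[D]reimE reD0 add0r.
  have imD0 : im D != 0 by apply: contraNneq D0 => imD0; rewrite DE imD0 mul0r.
  move: c1; rewrite DE -!mulrA; move: (im D) (im_Fq D) imD0 => s s_K s0.
  rewrite !(imZ _ s_K) !(reZ _ s_K) => c1; apply: (mulfI s0); rewrite c1 /X; ring.
have := im_X 1; rewrite -(im_X 0) mulr0 mulr1 im_eps im0K ?Fq0 // => /eqP.
by rewrite oner_eq0.
Qed.

Lemma delta_neq0 : delta != 0.
Proof.
apply/eqP=> d0; move: eps_notin; have := epsE; rewrite d0 addr0 => /eqP.
rewrite -subr_eq0 expr2 -{3}[eps]mulr1 -mulrBr mulf_eq0 subr_eq0.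
by case/orP=> /eqP ->; rewrite ?Fq0 ?Fq1.
Qed.

(** For w = (0, w1, w2, w3), the pencil based at (1,0,0,0) gives w1 = w2. If w1
    were nonzero, the pencil based at a point with x1 = g in the subfield and x2
    = 0 would have re (d w1) = 0 by its quadratic coefficient, and then its
    linear coefficient would determine g. Since 1 and delta are two possible
    values of g, this is absurd. *)
Lemma sublines_infinite (w : 'rV[F]_4) :
  w 0 0 = 0 -> sublines_through w -> w 0 1 = 0 /\ w 0 2 = 0.
Proof.
move=> w0 lines_w.
have lines_aff p1 p2 p3 : im p3 = Gam p1 + Gam p2 ->
    exists2 d, d != 0 & forall k, k \in K ->
      im (p3 + k * (d * w 0 3)) = Gam (p1 + k * (d * w 0 1)) + Gam (p2 + k * (d * w 0 2)).
  move=> /eqP; rewrite -onH_aff => /lines_w[d d0 on_line]; exists d => // k k_K.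
  have := on_line k k_K; rewrite [w]row4_eta w0 row4Z row4D mulr0 addr0 onH_aff.
  by rewrite !row4E -!mulrA => /eqP.
have w12 : w 0 1 = w 0 2.
  have [|d d0 on_line] := lines_aff 0 0 0; first by rewrite !Gamma0 im0K ?Fq0 // addr0.
  have [|_ _ c3 c4] := @pencil_coefs0 0 0 0 (d * w 0 1) (d * w 0 2) (d * w 0 3).
    by move=> k k_K _; apply: on_line.
  have re12 := exps2_inj (re_Fq _) (re_Fq _) c4.
  move: c3; rewrite re12 => /addrI/exps_inj im12.
  by apply: (mulfI d0); rewrite [LHS]reimE [RHS]reimE re12 im12.
have [w1|w1] := eqVneq (w 0 1) 0; first by split; rewrite -?w12.
have im_g g : g \in K -> g != 0 -> im (eps * (w 0 3 / w 0 1)) = g.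
  move=> g_K g0.
  have [|d d0 on_line] := lines_aff g 0 (eps * Gam g).
    by rewrite Gamma0 addr0 mulrC imZ ?Gamma_Fq // im_eps mulr1.
  have [|c1 c2 _ _] := @pencil_coefs0 g 0 (eps * Gam g) (d * w 0 1) (d * w 0 2) (d * w 0 3).
    by move=> k k_K _; apply: on_line.
  move: c1 c2; rewrite -w12; set D := d * w 0 1.
  have D0 : D != 0 by rewrite mulf_neq0.
  have -> : d * w 0 3 = D * (w 0 3 / w 0 1) by rewrite /D; field.
  rewrite (re_id g_K) (im0K g_K) (re_id Fq0) (im0K Fq0) !mul0r !addr0 expr0n.
  rewrite (gtn_eqF sigma_gt0) mul0r => c1 /addIr/eqP.
  rewrite mulf_eq0 !expf_eq0 (negPf g0) /= andbF /= => /eqP reD0.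
  have DE : D = im D * eps by rewrite {1}[D]reimE reD0 add0r.
  have imD0 : im D != 0 by apply: contraNneq D0 => imD0; rewrite DE imD0 mul0r.
  by apply: (mulfI imD0); rewrite -imZ ?im_Fq // (mulrA (im D)) -DE c1 mulrC.
move: delta_neq1; rewrite -(im_g _ delta_in delta_neq0) (im_g 1 Fq1 (oner_neq0 _)).
by rewrite eqxx.
Qed.

Lemma sublines_throughP (w : 'rV[F]_4) : sublines_through w -> w = row4 0 0 0 (w 0 3).
Proof.
move=> lines_w; have w0 : w 0 0 = 0.
  by apply/eqP/negPn/negP=> /sublines_affine_absurd; apply.
by have [w1 w2] := sublines_infinite w0 lines_w; rewrite {1}[w]row4_eta w0 w1 w2.
Qed.

(** * The invariant flag *)

Implicit Types v : 'rV[F]_4.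

Lemma mem_BT (P : point F) v : v != 0 -> v \in vectors P -> (P \in BT q sigma eps) = onH v.
Proof.
move=> v0 vP; rewrite inE; apply/existsP/idP => [[w /and3P[wP w0]]|onH_v].
  move: wP; rewrite (pointE v0 vP) => /imsetP[a _ w_av].
  by rewrite w_av onHZ //; apply: contraNneq w0 => a0; rewrite w_av a0 scale0r.
by exists v; rewrite vP v0.
Qed.

(** Membership in the variety can be tested on vectors, the zero vector
    included, because on_BT holds at zero. *)
Lemma AutBTP phi (A : {'GL_4[F]}) :
  reflect (forall v, onH (Defs.semilinear phi A v) = onH v)
          (collineation phi A \in AutBT q sigma eps).
Proof.
rewrite inE; have -> /= : collineation phi A \in PGammaL4 F by apply: (imset_f _ (x := (phi, A))).
apply: (iffP astabsP) => [stab v|onH_f P] /=.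
  have [->|v0] := eqVneq v 0; first by rewrite semilinear0.
  have /= := stab (span_point v0); rewrite apermE (mem_BT v0 (mem_span_point v0)) => <-.
  rewrite (@mem_BT _ (Defs.semilinear phi A v)) ?semilinear_eq0 //.
  by rewrite mem_collineation ?mem_span_point.
have [v v0 vP] := point_vector P; rewrite /= apermE (mem_BT v0 vP) -onH_f.
by rewrite (@mem_BT _ (Defs.semilinear phi A v)) ?semilinear_eq0 // mem_collineation.
Qed.

Lemma onH_inf_translate v a : v 0 0 = 0 -> onH (v + row4 0 0 0 a) = onH v.
Proof. by move=> v0; rewrite [v]row4_eta v0 row4D !addr0 !onH_inf. Qed.

(** At an affine point, adding a multiple of (0,0,0,1) changes im x3
    arbitrarily. *)
Lemma onH_translate_inf v : (forall a, onH (v + row4 0 0 0 a) = onH v) -> v 0 0 = 0.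
Proof.
move=> inv_v; apply/eqP/negPn/negP=> v0.
set y1 := v 0 1 / v 0 0; set y2 := v 0 2 / v 0 0; set y3 := v 0 3 / v 0 0.
have onH_t t : t \in K -> (im y3 + t == Gam y1 + Gam y2) = onH v.
  move=> t_K; rewrite -(inv_v (v 0 0 * (t * eps))).
  rewrite [X in onH (X + _)](row4_affine v0).
  have -> : row4 0 0 0 (v 0 0 * (t * eps)) = v 0 0 *: row4 0 0 0 (t * eps).
    by rewrite row4Z !mulr0.
  by rewrite -scalerDr onHZ // row4D !addr0 onH_aff imD imZ // im_eps mulr1.
(* The translates by t and by t + 1 differ: the first is on the variety and the
   second is not. *)
pose t := Gam y1 + Gam y2 + im y3.
have t_K : t \in K by apply: FqD (im_Fq _); apply: FqD; apply: Gamma_Fq.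
have tE : im y3 + t = Gam y1 + Gam y2 by rewrite /t addrC addK2.
clearbody t; have := onH_t _ t_K; rewrite -(onH_t _ (FqD t_K Fq1)) (addrA (im y3)) tE.
by rewrite eqxx -[X in _ == X]addr0 (inj_eq (addrI _)) oner_eq0.
Qed.

Section Automorphism.

Variables (phi : field_aut F) (A : {'GL_4[F]}).
Hypothesis onH_f : forall v, onH (Defs.semilinear phi A v) = onH v.
Local Notation f := (Defs.semilinear phi A).
Local Notation M := (GLval A).

Lemma sublines_semilinear w : sublines_through w -> sublines_through (f w).
Proof.
move=> lines_w u; have [v <-] := semilinear_surj phi A u.
rewrite onH_f => /lines_w[d d0 on_line]; exists (phi d).
  by rewrite -(field_aut0 phi) (inj_eq perm_inj).
move=> k; have <- : phi ((aut_perm phi)^-1%g k) = k by rewrite permKV.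
rewrite field_aut_Fq => k_K.
by rewrite -field_autM -semilinearZ -semilinearD onH_f on_line.
Qed.

Lemma aut_fixes_Pinf : f (row4 0 0 0 1) = row4 0 0 0 (M 3 3) /\ M 3 3 != 0.
Proof.
have /sublines_throughP := sublines_semilinear (sublines_Pinf (oner_neq0 _)).
have -> : f (row4 0 0 0 1) 0 3 = M 3 3.
  by rewrite semilinearE !row4E field_aut0 field_aut1E !mul0r !add0r mul1r.
move=> fE; split => //; apply/eqP=> M33; have /eqP := fE.
have -> : row4 0 0 0 (M 3 3) = 0 by apply/rowP=> -[[|[|[|[|j]]]] lt_j] //; rewrite !mxE M33.
by rewrite semilinear_eq0 (negPf (Pinf_neq0 F)).
Qed.

Lemma aut_mx_row3 : [/\ M 3 0 = 0, M 3 1 = 0 & M 3 2 = 0].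
Proof.
have [/rowP fE _] := aut_fixes_Pinf.
by split; [have := fE 0|have := fE 1|have := fE 2];
  rewrite semilinearE !row4E field_aut0 field_aut1E !mul0r !add0r mul1r.
Qed.

(** An automorphism carries translations along P_infty to translations along
    P_infty, since it fixes that point. *)
Lemma aut_preserves_Piinf v : v 0 0 = 0 -> (f v) 0 0 = 0.
Proof.
move=> v0; apply: onH_translate_inf => a; rewrite onH_f.
have [fE M33] := aut_fixes_Pinf.
have -> : row4 0 0 0 a = f ((aut_perm phi)^-1%g (a / M 3 3) *: row4 0 0 0 1).
  by rewrite semilinearZ fE permKV row4Z !mulr0 divfK.
by rewrite -semilinearD onH_f row4Z !mulr0 onH_inf_translate.
Qed.

Lemma aut_mx_col0 : [/\ M 1 0 = 0, M 2 0 = 0, M 3 0 = 0 & M 0 0 != 0].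
Proof.
have M10 : M 1 0 = 0.
  have := @aut_preserves_Piinf (row4 0 1 0 0); rewrite !row4E semilinearE !row4E.
  by rewrite field_aut0 field_aut1E !mul0r !addr0 add0r mul1r; apply.
have M20 : M 2 0 = 0.
  have := @aut_preserves_Piinf (row4 0 0 1 0); rewrite !row4E semilinearE !row4E.
  by rewrite field_aut0 field_aut1E !mul0r !addr0 !add0r mul1r; apply.
have [M30 _ _] := aut_mx_row3; split=> //.
apply/eqP=> M00; have [v /rowP/(_ 0)] := semilinear_surj phi A (row4 1 0 0 0).
by rewrite semilinearE M00 M10 M20 M30 !mulr0 !addr0 !row4E => /esym/eqP; rewrite oner_eq0.
Qed.

(** The matrix form of the invariance of l_infty. The variety contains the line
    of the points (1, t, t, 0), so it contains the image of that line. Reading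
    the image as a family of pencils, one for each scalar d, the top coefficient
    gives re (d * w1) = re (d * w2) for its direction (0, w1, w2, w3). *)
Lemma aut_mx_linf : M 1 1 + M 2 1 = M 1 2 + M 2 2.
Proof.
have [M10 M20 M30 M00] := aut_mx_col0; have [_ M31 M32] := aut_mx_row3.
apply/eqP; rewrite -add_eq0; apply/eqP.
set c := M 0 0 in M00; pose w1 := (M 1 1 + M 2 1) / c; pose w2 := (M 1 2 + M 2 2) / c.
suff /(congr1 ( *%R^~ c)) : w1 + w2 = 0 by rewrite mulrDl !divfK // mul0r.
apply: re_mul_eq0 => d; pose w3 := (M 1 3 + M 2 3) / c.
have [|_ _ _ c4] := @pencil_coefs0 (M 0 1 / c) (M 0 2 / c) (M 0 3 / c) (d * w1) (d * w2) (d * w3).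
  move=> k k_K k0; apply/eqP; rewrite -onH_aff -(onHZ _ M00).
  (* The preimage under phi of the parameter along the image line. *)
  pose t := (aut_perm phi)^-1%g (k * d).
  have phi_t : phi t = k * d by rewrite permKV.
  have -> : c *: row4 1 (M 0 1 / c + k * (d * w1)) (M 0 2 / c + k * (d * w2))
              (M 0 3 / c + k * (d * w3))
            = f (row4 1 t t 0).
    rewrite [RHS]row4_eta !semilinearE !row4E field_aut0 field_aut1E phi_t -/c.
    rewrite M10 M20 /w1 /w2 /w3 row4Z !mul0r !mulr0 !addr0; congr row4; by field.
  by rewrite onH_f onH_aff im0K ?Fq0 // addxx.
have re12 := exps2_inj (re_Fq _) (re_Fq _) c4.
by rewrite mulrC mulrDr reD re12 addxx.
Qed.

Lemma aut_preserves_linf v : v 0 0 = 0 -> v 0 1 + v 0 2 = 0 ->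
  (f v) 0 0 = 0 /\ (f v) 0 1 + (f v) 0 2 = 0.
Proof.
move=> v0 /eqP; rewrite add_eq0 => /eqP v12; split; first exact: aut_preserves_Piinf.
have [_ M31 M32] := aut_mx_row3.
rewrite !semilinearE v0 v12 M31 M32 field_aut0 !mul0r !mulr0 !add0r !addr0.
by rewrite -!mulrDr aut_mx_linf addxx mulr0.
Qed.

Lemma collineation_fixes_flag (s := collineation phi A) :
  [/\ s (Pinf F) = Pinf F, [set s P | P in linf F] = linf F
    & [set s P | P in Piinf F] = Piinf F].
Proof.
have fix_sub (S : {set point F}) : [set s P | P in S] \subset S -> [set s P | P in S] = S.
  by move=> sub; apply/eqP; rewrite eqEcard sub (card_imset _ perm_inj) leqnn.
split.
- apply: (@collineation_mem_eq _ _ _ _ _ (row4 0 0 0 1)).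
  + exact: Pinf_neq0.
  + exact: mem_span_point.
  + have [-> _] := aut_fixes_Pinf.
    have -> : row4 0 0 0 (M 3 3) = M 3 3 *: row4 0 0 0 1 by rewrite row4Z !mulr0 mulr1.
    exact/pointZ/mem_span_point.
- apply: fix_sub; apply/subsetP=> _ /imsetP[P + ->]; rewrite !inE => /subsetP P_linf.
  apply/subsetP=> _ /collineationP[v /P_linf + ->]; rewrite !inE => /andP[/eqP v0 /eqP v12].
  by have [-> ->] := aut_preserves_linf v0 v12; rewrite eqxx.
- apply: fix_sub; apply/subsetP=> _ /imsetP[P + ->]; rewrite !inE => /subsetP P_inf.
  apply/subsetP=> _ /collineationP[v /P_inf + ->]; rewrite !inE => /eqP v0.
  by rewrite aut_preserves_Piinf.
Qed.

End Automorphism.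

(** * Similarities of the affine equation *)

(** Decomposing x along 1 and eps gives re ((m + re m) * x) = 0 for all x, and
    the form re (x * y) is nondegenerate. *)
Lemma re_stable_scalar m : (forall x, re x = 0 -> re (m * x) = 0) -> m = re m.
Proof.
move=> re_m; apply/eqP; rewrite -add_eq0; apply/eqP/re_mul_eq0 => x.
rewrite mulrDl reD (reZ _ (re_Fq m)).
have -> : re (m * x) = re (m * re x) + re (m * (im x * eps)).
  by rewrite -reD -mulrDr -reimE.
rewrite [re (m * (im x * eps))]re_m; last by rewrite (reZ _ (im_Fq x)) re_eps mulr0.
by rewrite addr0 [m * re x]mulrC (reZ _ (re_Fq x)) mulrC addxx.
Qed.

(** Injectivity of x |-> x^(sigma + 2) shows that the two linear forms agree
    when re x1 = re x2, so they differ by r * (re x1 + re x2). Since u^(sigma +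
    2) + (u + r)^(sigma + 2) depends genuinely on u, the first form does not
    involve im x1 and im x2, and is m * re x1 + n * re x2. The mixed
    coefficients of the resulting identity in two variables force m * n = 0. *)
Lemma tits_form_similarity c m11 m12 m21 m22 : c != 0 ->
  (forall x1 x2, c * (re x1 ^+ (sigma + 2) + re x2 ^+ (sigma + 2))
     = re (m11 * x1 + m21 * x2) ^+ (sigma + 2) + re (m12 * x1 + m22 * x2) ^+ (sigma + 2)) ->
  exists r, [/\ r \in K, c = r ^+ (sigma + 2) &
    [/\ m11 = r, m21 = 0, m12 = 0 & m22 = r] \/ [/\ m11 = 0, m21 = r, m12 = r & m22 = 0]].
Proof.
move=> c0 form.
have zero_s2 : 0 ^+ (sigma + 2) = 0 :> F by rewrite expr0n addn2.
have one_s2 : 1 ^+ (sigma + 2) = 1 :> F by rewrite expr1n.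
have re_eq x1 x2 : re x1 = re x2 -> re ((m11 + m12) * x1 + (m21 + m22) * x2) = 0.
  move=> re12; have := form x1 x2; rewrite re12 addxx mulr0 => /esym/eqP.
  rewrite add_eq0 => /eqP/(exps2_inj (re_Fq _) (re_Fq _)) eq12.
  have -> : (m11 + m12) * x1 + (m21 + m22) * x2
            = (m11 * x1 + m21 * x2) + (m12 * x1 + m22 * x2) by ring.
  by rewrite reD eq12 addxx.
have re0 : re 0 = 0 by rewrite re_id ?Fq0.
have n1E : m11 + m12 = re (m11 + m12).
  apply: re_stable_scalar => x x0.
  by have := re_eq x 0; rewrite mulr0 addr0; apply; rewrite x0 re0.
have n2E : m21 + m22 = re (m21 + m22).
  apply: re_stable_scalar => x x0.
  by have := re_eq 0 x; rewrite mulr0 add0r; apply; rewrite x0 re0.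
set r := re (m11 + m12) in n1E.
have r_K : r \in K by apply: re_Fq.
have n2r : m21 + m22 = r.
  rewrite n2E; apply/esym/eqP; rewrite -add_eq0 /r -reD; apply/eqP.
  by have := re_eq 1 1 erefl; rewrite !mulr1.
have m12E : m12 = m11 + r by rewrite -n1E addrA addxx add0r.
have m22E : m22 = m21 + r by rewrite -n2r addrA addxx add0r.
clearbody r; move: form; rewrite {}m12E {}m22E => form {n1E n2E n2r re_eq}.
have formE x1 x2 u h : re (m11 * x1 + m21 * x2) = u -> re x1 + re x2 = h ->
    c * (re x1 ^+ (sigma + 2) + re x2 ^+ (sigma + 2))
    = u ^+ sigma * (r * h) ^+ 2 + u ^+ 2 * (r * h) ^+ sigma + (r * h) ^+ (sigma + 2).
  move=> uE hE; rewrite (form x1 x2).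
  have -> : (m11 + r) * x1 + (m21 + r) * x2 = m11 * x1 + m21 * x2 + r * (x1 + x2) by ring.
  rewrite (reD (m11 * x1 + _)) reZ // (reD x1) uE hE.
  by rewrite !exprD expDs expD2; char2_ring.
have form1 x1 x2 u : re x1 = 1 -> re x2 = 0 -> re (m11 * x1 + m21 * x2) = u ->
    c = u ^+ sigma * r ^+ 2 + u ^+ 2 * r ^+ sigma + r ^+ (sigma + 2).
  move=> x1E x2E uE; have := formE x1 x2 u 1 uE; rewrite x1E x2E addr0 => /(_ erefl).
  by rewrite one_s2 zero_s2 addr0 !mulr1.
have r0 : r != 0.
  apply: contraNneq c0 => r0; rewrite (form1 1 0 _ (re_id Fq1) re0 erefl) r0.
  by rewrite zero_s2 !expr0n (gtn_eqF sigma_gt0) !mulr0 !addr0.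
(* A form u = m + s * k with s nonzero would make the right-hand side depend on
   k. *)
have indep m s : s \in K ->
    (forall k, k \in K -> k != 0 ->
      c = (m + s * k) ^+ sigma * r ^+ 2 + (m + s * k) ^+ 2 * r ^+ sigma + r ^+ (sigma + 2)) ->
    s = 0.
  move=> s_K eq_c.
  have [|_ _ /eqP + _ _] := @Fq_poly_eq0
    (c + m ^+ sigma * r ^+ 2 + m ^+ 2 * r ^+ sigma + r ^+ (sigma + 2)) 0
    (s ^+ 2 * r ^+ sigma) (s ^+ sigma * r ^+ 2) 0.
    move=> k k_K k0; rewrite {1}(eq_c k k_K k0) expDs expD2 !exprMn.
    by move: (r ^+ (sigma + 2)) => t; char2_ring.
  by rewrite mulf_eq0 !expf_eq0 (negPf r0) andbF orbF => /eqP.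
have m11E : m11 = re m11.
  apply: re_stable_scalar => x x0; apply: (indep (re m11)); first exact: re_Fq.
  move=> k k_K k0; apply: (form1 (1 + k * x) 0) => //.
    by rewrite reD reZ // x0 (re_id Fq1) mulr0 addr0.
  have -> : m11 * (1 + k * x) + m21 * 0 = m11 + k * (m11 * x) by ring.
  by rewrite reD reZ // [k * _]mulrC.
have m21E : m21 = re m21.
  apply: re_stable_scalar => x x0; apply: (indep (re m11)); first exact: re_Fq.
  move=> k k_K k0; apply: (form1 1 (k * x)).
  - exact: re_id Fq1.
  - by rewrite reZ // x0 mulr0.
  have -> : m11 * 1 + m21 * (k * x) = m11 + k * (m21 * x) by ring.
  by rewrite reD reZ // [k * _]mulrC.
have [m_K n_K] : m11 \in K /\ m21 \in K by rewrite m11E m21E !re_Fq.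
move: m11 m21 m_K n_K {m11E m21E form1 formE} form => m n m_K n_K form.
have sq x : x \in K -> (x ^+ sigma) ^+ sigma = x ^+ 2 by apply: Fq_sigma_sq.
have [|_ _ /eqP c2 /eqP c3 /eqP c4] := @Fq_poly_eq0
  (c + n ^+ (sigma + 2) + (n + r) ^+ (sigma + 2)) 0
  (n ^+ sigma * m ^+ 2 + (n + r) ^+ sigma * (m + r) ^+ 2)
  (m ^+ sigma * n ^+ 2 + (m + r) ^+ sigma * (n + r) ^+ 2)
  (c + m ^+ (sigma + 2) + (m + r) ^+ (sigma + 2)).
  move=> k k_K k0; have := form k 1; rewrite !mulr1 !re_id ?(FqD, FqM, Fq1) //.
  rewrite one_s2 mul0r addr0 => /eqP; rewrite -add_eq0 => /eqP <-.
  rewrite !exprD; move: (m + r) (n + r) => m' n'.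
  by rewrite !expDs !expD2 !exprMn; char2_ring.
move: c2 c3 c4; rewrite -addrA !add_eq0 => /eqP c2 /eqP c3 /eqP cE.
(* Raising c2 to the power sigma and dividing by c3 compares m ^+ sigma with (m
   + r) ^+ sigma, unless the factors divided by vanish. *)
have prod0 : m ^+ sigma * n ^+ 2 * (m ^+ sigma + (m + r) ^+ sigma) = 0.
  have /(congr1 (fun x => x ^+ sigma)) /= := c2.
  rewrite !exprMn !sq ?FqD // => c2s.
  move: c3 c2s; move: (m ^+ sigma) ((m + r) ^+ sigma) (n ^+ 2) ((n + r) ^+ 2).
  move=> a a' b b' c3 c2s.
  have -> : a * b * (a + a') = b * (a * a) + a' * (a * b) by ring.
  by rewrite c2s c3 [b' * _]mulrC -mulrA addxx.
have mn0 : m ^+ sigma * n ^+ 2 = 0.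
  move/eqP: prod0; rewrite mulf_eq0 => /orP[/eqP //|].
  rewrite add_eq0 => /eqP/exps_inj/eqP; rewrite -{1}[m]addr0 (inj_eq (addrI _)).
  by rewrite eq_sym (negPf r0).
exists r; split; first exact: r_K.
  move/eqP: mn0; rewrite mulf_eq0 !expf_eq0 sigma_gt0 /= => /orP[/eqP m0|/eqP n0].
    by rewrite cE m0 zero_s2 !add0r.
  have /eqP := c2; rewrite n0 expr0n (gtn_eqF sigma_gt0) mul0r add0r eq_sym.
  rewrite mulf_eq0 !expf_eq0 (negPf r0) andbF /= => /eqP mr0.
  by rewrite cE mr0 zero_s2 addr0; congr (_ ^+ _); apply/eqP; rewrite -add_eq0 mr0.
move/eqP: mn0; rewrite mulf_eq0 !expf_eq0 sigma_gt0 /= => /orP[/eqP m0|/eqP n0].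
  right; have /eqP := c2; rewrite m0 expr0n mulr0 add0r eq_sym.
  rewrite mulf_eq0 !expf_eq0 (negPf r0) sigma_gt0 orbF /= => nr0.
  split; [exact: erefl | apply/eqP | exact: erefl | exact/eqP].
  by rewrite -add_eq0.
left; have /eqP := c2; rewrite n0 expr0n (gtn_eqF sigma_gt0) mul0r add0r eq_sym.
rewrite mulf_eq0 !expf_eq0 (negPf r0) andbF /= => mr0.
split; [apply/eqP | exact: erefl | exact/eqP | exact: erefl].
by rewrite -add_eq0.
Qed.

(** At x2 = 0 the quadratic coefficient gives re a1 = 0 and r ^+ 2 = c, hence r
    ^+ sigma = 1 and r = 1. The linear coefficient expresses m13 and m23 through
    im a1 and im a2, and the constant one gives im a3. *)
Lemma tau_parameters c r a1 a2 a3 m13 m23 : r != 0 -> c = r ^+ (sigma + 2) ->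
  (forall x1 x2, im (a3 + (m13 * x1 + m23 * x2)) + c * (Gam x1 + Gam x2)
     = Gam (a1 + r * x1) + Gam (a2 + r * x2)) ->
  r \in K ->
  [/\ r = 1, a1 = im a1 * eps, a2 = im a2 * eps,
      a3 = re a3 + (im a1 + im a2) ^+ sigma * eps
    & m13 = im a1 + im a1 * eps /\ m23 = im a2 + im a2 * eps].
Proof.
move=> r0 cE sim r_K.
have coefs x1 x2 := @pencil_coefs c a1 a2 a3 (r * x1) (r * x2) (m13 * x1 + m23 * x2) x1 x2.
have {}coefs x1 x2 :
  [/\ im a3 = Gam a1 + Gam a2,
      im (m13 * x1 + m23 * x2)
      = r * (re a1 * im x1 + im a1 * re x1 + (re a2 * im x2 + im a2 * re x2))
    & c * (re x1 * im x1 + re x2 * im x2)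
      = r ^+ 2 * (re a1 ^+ sigma * re x1 ^+ 2 + re x1 * im x1
                  + (re a2 ^+ sigma * re x2 ^+ 2 + re x2 * im x2))].
  case: (coefs x1 x2) => [k k_K _|c0 c1 c2 _ _].
    have -> : k * (m13 * x1 + m23 * x2) = m13 * (k * x1) + m23 * (k * x2) by ring.
    by rewrite sim !(mulrCA k).
  by rewrite c0 c1 c2 !(imZ _ r_K) !(reZ _ r_K); split=> //; ring.
have re0 : re 0 = 0 by rewrite re_id ?Fq0.
have im0 : im 0 = 0 by rewrite im0K ?Fq0.
have re_1 : re 1 = 1 by rewrite re_id ?Fq1.
have im_1 : im 1 = 0 by rewrite im0K ?Fq1.
have ra0 a : 0 = r ^+ 2 * (a ^+ sigma) -> a = 0.
  by move/esym/eqP; rewrite mulf_eq0 !expf_eq0 (negPf r0) andbF /= => /andP[_ /eqP].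
have re_a1 : re a1 = 0.
  apply: ra0; have [_ _] := coefs 1 0.
  by rewrite re_1 im_1 re0 im0 !expr0n expr1n !mulr0 !addr0 !mulr1 mulr0.
have re_a2 : re a2 = 0.
  apply: ra0; have [_ _] := coefs 0 1.
  by rewrite re_1 im_1 re0 im0 !expr0n expr1n !mulr0 !addr0 !add0r !mulr1 mulr0.
have r1 : r = 1.
  have [_ _] := coefs (1 * eps + 1) 0.
  rewrite reD imD re_a1 re_a2 mul1r re_eps im_eps re_1 im_1 re0 im0 !mul0r !addr0 add0r.
  rewrite expr0n (gtn_eqF sigma_gt0) !mul0r add0r !mulr1 cE exprD => r_eq.
  by apply: exps_inj; apply: (mulIf (expf_neq0 2 r0)); rewrite /= r_eq expr1n mul1r addr0 mulr1.
have aE a : re a = 0 -> a = im a * eps by move=> a0; rewrite {1}[a]reimE a0 add0r.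
have mE m a : (forall x, im (m * x) = im a * re x) -> m = im a + im a * eps.
  move=> im_m; apply/eqP; rewrite -add_eq0; apply/eqP/im_mul_eq0 => x.
  rewrite mulrDl imD im_m.
  have -> : (im a + im a * eps) * x = im a * ((1 + eps) * x) by ring.
  by rewrite (imZ _ (im_Fq a)) im_mul_1eps addxx.
split=> //; try exact: aE.
  have [im_a3 _ _] := coefs 0 0; rewrite {1}[a3]reimE im_a3 !GammaE re_a1 re_a2 (expDs (im a1)).
  by rewrite expr0n addn2 /= !mul0r !add0r.
split; apply: mE => x.
  have [_ + _] := coefs x 0.
  by rewrite r1 re_a1 re_a2 re0 im0 mul1r !mulr0 !mul0r !addr0 add0r.
have [_ + _] := coefs 0 x.
by rewrite r1 re_a1 re_a2 re0 im0 mul1r !mulr0 !mul0r !add0r.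
Qed.

Lemma row4_tau a b c d g1 g2 g3 : row4 a b c d *m tau_mx sigma eps g1 g2 g3
  = row4 a (a * (g1 * eps) + b) (a * (g2 * eps) + c)
      (a * (g3 + (g1 + g2) ^+ sigma * eps) + b * (g1 + g1 * eps) + c * (g2 + g2 * eps) + d).
Proof. by rewrite [LHS]row4_eta !mulmx4E !row4E !mxE /= !mulr0 !mulr1 !addr0 ?add0r. Qed.

Lemma onH_tau g1 g2 g3 v : g1 \in K -> g2 \in K -> g3 \in K ->
  onH (v *m tau_mx sigma eps g1 g2 g3) = onH v.
Proof.
move=> g1_K g2_K g3_K.
have [v0|v0] := eqVneq (v 0 0) 0.
  by rewrite [v]row4_eta v0 row4_tau !mul0r !add0r !onH_inf.
rewrite (row4_affine v0) -scalemxAl !onHZ // row4_tau !onH_aff !mul1r.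
move: (v 0 1 / v 0 0) (v 0 2 / v 0 0) (v 0 3 / v 0 0) => x1 x2 x3.
have mul_1eps x g : x * (g + g * eps) = g * ((1 + eps) * x) by ring.
have Gamma_shift x g : g \in K -> Gam (g * eps + x) = Gam x + g * re x + g ^+ sigma.
  move=> g_K; rewrite !GammaE reD imD reZ // imZ // re_eps im_eps mulr0 mulr1 add0r expDs.
  by ring.
rewrite !mul_1eps !imD !(imZ _ g1_K) !(imZ _ g2_K) !im_mul_1eps (im0K g3_K).
rewrite imZ ?FqX ?FqD // im_eps mulr1 !Gamma_shift // expDs.
rewrite -[RHS](inj_eq (addrI (g1 ^+ sigma + g2 ^+ sigma + g1 * re x1 + g2 * re x2))).
by congr (_ == _); ring.
Qed.

Lemma onH_theta v : onH (v *m theta_mx F) = onH v.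
Proof.
have [v0|v0] := eqVneq (v 0 0) 0.
  by rewrite [v]row4_eta v0 theta_row4 !onH_inf eq_sym.
by rewrite (row4_affine v0) -scalemxAl !onHZ // theta_row4 !onH_aff addrC.
Qed.

(** Comparing the equation of the variety at (x1, x2) and at its image puts the
    matrix under the two lemmas above; exchanging x1 and x2 reduces the second
    alternative for its linear part to the first. *)
Lemma linear_aut_classification (A : {'GL_4[F]}) :
  (forall v, onH (v *m GLval A) = onH v) ->
  exists g1 g2 g3 c, [/\ g1 \in K, g2 \in K, g3 \in K & c != 0] /\
    ((forall v, v *m GLval A = c *: (v *m tau_mx sigma eps g1 g2 g3))
     \/ (forall v, v *m GLval A = c *: (v *m theta_mx F *m tau_mx sigma eps g1 g2 g3))).
Proof.
move=> onH_A; pose M := GLval A.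
have onH_f v : onH (Defs.semilinear (field_aut1 F) A v) = onH v by rewrite linear_semilinearE.
have [M10 M20 M30 M00] := aut_mx_col0 onH_f; have [_ M31 M32] := aut_mx_row3 onH_f.
have [_ M33] := aut_fixes_Pinf onH_f.
rewrite -/M in M10 M20 M30 M00 M31 M32 M33 *.
pose B i j := M i j / M 0 0.
have M_B i j : M i j = M 0 0 * B i j by rewrite /B mulrC divfK.
have mulM a x1 x2 x3 : row4 a x1 x2 x3 *m M = M 0 0 *:
    row4 a (a * B 0 1 + (B 1 1 * x1 + B 2 1 * x2)) (a * B 0 2 + (B 1 2 * x1 + B 2 2 * x2))
      (a * B 0 3 + (B 1 3 * x1 + B 2 3 * x2) + B 3 3 * x3).
  rewrite [LHS]row4_eta !mulmx4E !row4E M10 M20 M30 M31 M32 row4Z.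
  by rewrite !mulr0 !addr0; congr row4;
    rewrite ?(M_B 0 1) ?(M_B 0 2) ?(M_B 0 3) ?(M_B _ 1) ?(M_B _ 2) ?(M_B _ 3); ring.
have B33_neq0 : B 3 3 != 0 by rewrite mulf_neq0 ?invr_eq0.
have onM x1 x2 x3 :
    (im (B 0 3 + (B 1 3 * x1 + B 2 3 * x2) + B 3 3 * x3)
       == Gam (B 0 1 + (B 1 1 * x1 + B 2 1 * x2)) + Gam (B 0 2 + (B 1 2 * x1 + B 2 2 * x2)))
    = (im x3 == Gam x1 + Gam x2).
  by rewrite -!onH_aff -[RHS]onH_A -/M mulM onHZ // !mul1r.
have sim_k k : k \in K -> im (B 0 3 + B 3 3 * k) = Gam (B 0 1) + Gam (B 0 2).
  move=> k_K; apply/eqP; have := onM 0 0 k.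
  by rewrite Gamma0 !mulr0 !addr0 (im0K k_K) eqxx.
(* Adding 1 to x3 preserves the variety, so the relative trace of B 3 3
   vanishes. *)
have c_K : B 3 3 \in K.
  rewrite -im_eq0; have := sim_k 1 Fq1; rewrite -(sim_k 0 Fq0) mulr1 mulr0 !imD (im0K Fq0).
  by move/addrI => ->.
have sim x1 x2 : im (B 0 3 + (B 1 3 * x1 + B 2 3 * x2)) + B 3 3 * (Gam x1 + Gam x2)
    = Gam (B 0 1 + (B 1 1 * x1 + B 2 1 * x2)) + Gam (B 0 2 + (B 1 2 * x1 + B 2 2 * x2)).
  apply/eqP; have := onM x1 x2 ((Gam x1 + Gam x2) * eps).
  have G_K : Gam x1 + Gam x2 \in K by rewrite FqD ?Gamma_Fq.
  rewrite (imZ _ G_K) im_eps mulr1 eqxx => /eqP <-.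
  by rewrite (imD (_ + _)) (imZ (_ * eps) c_K) (imZ _ G_K) im_eps mulr1.
have [|r [r_K cE alt]] := @tits_form_similarity (B 3 3) (B 1 1) (B 1 2) (B 2 1) (B 2 2) B33_neq0.
  move=> x1 x2; have [|_ _ _ _ ->] := @pencil_coefs (B 3 3) (B 0 1) (B 0 2) (B 0 3)
     (B 1 1 * x1 + B 2 1 * x2) (B 1 2 * x1 + B 2 2 * x2) (B 1 3 * x1 + B 2 3 * x2) x1 x2 => //.
  move=> k k_K _; have := sim (k * x1) (k * x2).
  by rewrite !(mulrCA _ k) -!mulrDr.
have r0 : r != 0 by apply: contraNneq B33_neq0 => r0; rewrite cE r0 expr0n addn2.
(* Both alternatives for the linear part end with the same computation, for
   (m13, m23) in either order. *)
have finish m13 m23 :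
    (forall x1 x2, im (B 0 3 + (m13 * x1 + m23 * x2)) + B 3 3 * (Gam x1 + Gam x2)
       = Gam (B 0 1 + r * x1) + Gam (B 0 2 + r * x2)) ->
    exists g1 g2 g3, [/\ g1 \in K, g2 \in K & g3 \in K] /\
      forall a x1 x2 x3, row4 a x1 x2 x3 *m tau_mx sigma eps g1 g2 g3
       = row4 a (a * B 0 1 + r * x1) (a * B 0 2 + r * x2)
           (a * B 0 3 + (m13 * x1 + m23 * x2) + B 3 3 * x3).
  move=> simr; have [r1 a1E a2E a3E [m13E m23E]] := tau_parameters r0 cE simr r_K.
  exists (im (B 0 1)), (im (B 0 2)), (re (B 0 3)).
  split=> [|a x1 x2 x3]; first by rewrite !im_Fq re_Fq.
  rewrite row4_tau -m13E -m23E -a3E -a1E -a2E cE r1 expr1n !mul1r addrA.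
  by rewrite [x1 * _]mulrC [x2 * _]mulrC.
case: alt => -[B11 B21 B12 B22].
  have [|g1 [g2 [g3 [[g1_K g2_K g3_K] tauE]]]] := finish (B 1 3) (B 2 3).
    by move=> x1 x2; rewrite sim B11 B12 B21 B22 !mul0r addr0 add0r.
  exists g1, g2, g3, (M 0 0); split=> //; left=> v.
  by rewrite [v]row4_eta mulM tauE B11 B12 B21 B22 !mul0r !addr0 !add0r.
have [|g1 [g2 [g3 [[g1_K g2_K g3_K] tauE]]]] := finish (B 2 3) (B 1 3).
  move=> x1 x2; have := sim x2 x1; rewrite B11 B12 B21 B22 !mul0r addr0 add0r => <-.
  by rewrite [Gam x1 + _]addrC [B 2 3 * _ + _]addrC.
exists g1, g2, g3, (M 0 0); split=> //; right=> v.
rewrite [v]row4_eta mulM theta_row4 tauE B11 B12 B21 B22 !mul0r !addr0 !add0r.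
by rewrite [B 2 3 * _ + _]addrC.
Qed.

(** * The group of linear automorphisms *)

(** The generators of E, which turn out to form a group already. *)
Definition tau_set : {set {perm point F}} :=
  [set tau sigma eps g.1.1 g.1.2 g.2 | g in setX (setX K K) K].

Lemma tau_setP s :
  reflect (exists g1 g2 g3, [/\ g1 \in K, g2 \in K & g3 \in K] /\ s = tau sigma eps g1 g2 g3)
          (s \in tau_set).
Proof.
apply: (iffP imsetP) => [[[[g1 g2] g3]]|[g1 [g2 [g3 [[K1 K2 K3] ->]]]]].
  by rewrite !in_setX /= => /andP[/andP[K1 K2] K3] ->; exists g1, g2, g3.
by exists (g1, g2, g3); rewrite // !in_setX /= K1 K2.
Qed.

(** The twist by delta comes from (g * eps) * (h + h * eps) = delta * g * h. *)
Lemma tauM g1 g2 g3 h1 h2 h3 :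
  (tau sigma eps g1 g2 g3 * tau sigma eps h1 h2 h3)%g
  = tau sigma eps (g1 + h1) (g2 + h2) (g3 + h3 + delta * (g1 * h1 + g2 * h2)).
Proof.
rewrite -linear_collineationM; apply: (@eq_collineation _ 1); rewrite ?oner_neq0 // => v.
rewrite scale1r !linear_semilinearE /= mulmxA [v]row4_eta !row4_tau.
have -> : g1 + h1 + (g2 + h2) = (g1 + g2) + (h1 + h2) by ring.
rewrite (expDs (g1 + g2)); move: ((g1 + g2) ^+ sigma) ((h1 + h2) ^+ sigma) => s t.
by congr row4; char2_ring.
Qed.

Lemma tau0 : tau sigma eps 0 0 0 = 1%g.
Proof.
apply/permP=> P; rewrite perm1; have [v v0 vP] := point_vector P.
apply: (collineation_mem_eq v0 vP); rewrite linear_semilinearE /= [v]row4_eta row4_tau.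
rewrite addr0 expr0n (gtn_eqF sigma_gt0) !mul0r !addr0 !mulr0 !addr0 !add0r.
by rewrite -row4_eta.
Qed.

Lemma tau_set_group : group_set tau_set.
Proof.
apply/group_setP; split=> [|s t].
  by apply/tau_setP; exists 0, 0, 0; rewrite Fq0 tau0.
case/tau_setP=> [g1 [g2 [g3 [[K1 K2 K3] ->]]]].
case/tau_setP=> [h1 [h2 [h3 [[L1 L2 L3] ->]]]].
apply/tau_setP; rewrite tauM; do 3!eexists; split; last by [].
by split; rewrite ?(FqD, FqM) ?delta_in.
Qed.

Lemma E_tau_set : E q sigma eps = tau_set.
Proof. exact: gen_set_id tau_set_group. Qed.

(** The parameters can be read off from the image of the point (1,0,0,0). *)
Lemma card_tau_set : #|tau_set| = (q ^ 3)%N.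
Proof.
rewrite card_in_imset.
  by rewrite !cardsX card_Fq expnSr mulnn.
move=> [[g1 g2] g3] [[h1 h2] h3]; rewrite !in_setX /=.
move=> /andP[/andP[g1_K g2_K] g3_K] /andP[/andP[h1_K h2_K] h3_K] eq_tau.
have e0_neq0 : row4 1 0 0 0 != 0 :> 'rV[F]_4.
  by apply/eqP=> /matrixP/(_ 0 0)/eqP; rewrite !mxE /= oner_eq0.
pose P := span_point e0_neq0.
have im_tau k1 k2 k3 : row4 1 (k1 * eps) (k2 * eps) (k3 + (k1 + k2) ^+ sigma * eps)
    \in vectors (tau sigma eps k1 k2 k3 P).
  have := mem_collineation (field_aut1 F) (FinRing.Unit (tau_mx_unit sigma eps k1 k2 k3))
    (mem_span_point e0_neq0).
  by rewrite linear_semilinearE /= row4_tau !mul1r !mul0r !addr0.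
have := im_tau h1 h2 h3; rewrite -eq_tau (pointE _ (im_tau g1 g2 g3)); last first.
  by apply/eqP=> /matrixP/(_ 0 0)/eqP; rewrite !mxE /= oner_eq0.
case/imsetP=> a _; rewrite row4Z => /rowP rowE.
have := rowE 0; rewrite !row4E mulr1 => a1; move: rowE; rewrite -{}a1 !mul1r => rowE.
have eps0 : eps != 0 by apply: contraNneq eps_notin => ->; apply: Fq0.
have := rowE 1; rewrite !row4E => /(mulIf eps0) ->.
have := rowE 2; rewrite !row4E => /(mulIf eps0) ->.
have := rowE 3; rewrite !row4E.
move/(congr1 re); rewrite !re_coords ?FqX ?FqD // => ->; by [].
Qed.

Lemma theta_involution : (theta F * theta F)%g = 1%g.
Proof.
rewrite -linear_collineationM; apply/permP=> P; rewrite perm1.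
have [v v0 vP] := point_vector P.
apply: (collineation_mem_eq v0 vP); rewrite linear_semilinearE /= mulmxA [v]row4_eta !theta_row4.
by rewrite -row4_eta.
Qed.

(** The two collineations move the point (0,1,0,0) to different points. *)
Lemma theta_notin_tau_set : theta F \notin tau_set.
Proof.
apply/tau_setP=> -[g1 [g2 [g3 [_ eq_tau]]]].
have e1_neq0 : row4 0 1 0 0 != 0 :> 'rV[F]_4.
  by apply/eqP=> /matrixP/(_ 0 1)/eqP; rewrite !mxE /= oner_eq0.
have := mem_collineation (field_aut1 F) (FinRing.Unit (tau_mx_unit sigma eps g1 g2 g3))
  (mem_span_point e1_neq0).
have := mem_collineation (field_aut1 F) (FinRing.Unit (theta_mx_unit F)) (mem_span_point e1_neq0).
rewrite -/(theta F) -/(tau sigma eps g1 g2 g3) eq_tau !linear_semilinearE /=.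
rewrite theta_row4 row4_tau => im_theta.
rewrite (pointE _ im_theta); last first.
  by apply/eqP=> /matrixP/(_ 0 2)/eqP; rewrite !mxE /= oner_eq0.
case/imsetP=> a _; rewrite row4Z => /rowP/(_ 1); rewrite !row4E mulr0 mul0r add0r => /eqP.
by rewrite oner_eq0.
Qed.

Lemma theta_tau g1 g2 g3 :
  (theta F * tau sigma eps g1 g2 g3)%g = (tau sigma eps g2 g1 g3 * theta F)%g.
Proof.
rewrite -!linear_collineationM; apply: (@eq_collineation _ 1); rewrite ?oner_neq0 // => v.
rewrite scale1r !linear_semilinearE /= !mulmxA [v]row4_eta !(theta_row4, row4_tau).
by rewrite [g2 + g1]addrC; congr row4; ring.
Qed.

Lemma linear_AutBT s : (s \in AutBT q sigma eps :&: PGL4 F)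
  = (s \in tau_set) || ((theta F * s)%g \in tau_set).
Proof.
apply/setIP/orP => [[s_aut /imsetP[A _ sE]]|].
  have onH_A v : onH (v *m GLval A) = onH v.
    by move: s_aut; rewrite sE => /AutBTP/(_ v); rewrite linear_semilinearE.
  have [g1 [g2 [g3 [c [[K1 K2 K3 c0] [AE|AE]]]]]] := linear_aut_classification onH_A.
    left; apply/tau_setP; exists g1, g2, g3; split=> //; rewrite sE.
    by apply: (eq_collineation c0) => v; rewrite !linear_semilinearE AE.
  right; apply/tau_setP; exists g1, g2, g3; split=> //.
  rewrite sE -linear_collineationM; apply: (eq_collineation c0) => v.
  rewrite !linear_semilinearE /= mulmxA AE; congr (_ *: (_ *m _)).
  by rewrite [v]row4_eta !theta_row4.
have lin_aut (A : {'GL_4[F]}) : (forall v, onH (v *m GLval A) = onH v) ->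
    collineation (field_aut1 F) A \in AutBT q sigma eps /\ collineation (field_aut1 F) A \in PGL4 F.
  move=> onH_A; split; last exact: imset_f.
  by apply/AutBTP=> v; rewrite linear_semilinearE.
case=> /tau_setP[g1 [g2 [g3 [[K1 K2 K3] sE]]]].
  by rewrite sE; apply: lin_aut => v; apply: onH_tau.
have -> : s = (theta F * tau sigma eps g1 g2 g3)%g.
  by rewrite -sE mulgA theta_involution mul1g.
rewrite -linear_collineationM; apply: lin_aut => v.
by rewrite /= mulmxA onH_tau // onH_theta.
Qed.

Lemma order_theta : #[theta F]%g = 2.
Proof.
apply: nt_prime_order => //; first by rewrite expgS expg1 theta_involution.
by apply: contraNneq theta_notin_tau_set => ->; exact: group1 (Group tau_set_group).
Qed.

Lemma linear_group_structure :
  [/\ AutBT q sigma eps :&: PGL4 F = (E q sigma eps * <[theta F]>)%g,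
      group_set (E q sigma eps * <[theta F]>)%g
    & #|(E q sigma eps * <[theta F]>)%g| = (2 * q ^ 3)%N].
Proof.
rewrite E_tau_set; pose T := Group tau_set_group.
have theta_norm : theta F \in 'N(T)%g.
  rewrite inE; apply/subsetP=> _ /imsetP[t /tau_setP[g1 [g2 [g3 [[K1 K2 K3] ->]]]] ->].
  have -> : (tau sigma eps g1 g2 g3 ^ theta F)%g = tau sigma eps g2 g1 g3.
    by rewrite conjgE -theta_tau mulKg.
  by apply/tau_setP; exists g2, g1, g3.
have cycle_norm : <[theta F]>%g \subset 'N(T)%g by rewrite cycle_subG.
have prodP s : (s \in (T * <[theta F]>)%g) = (s \in T) || ((theta F * s)%g \in T).
  rewrite -(normC cycle_norm) (cycle2g order_theta).
  apply/mulsgP/orP=> [[h t + tT ->]|[sT|sT]].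
  - rewrite !inE => /orP[]/eqP ->; first by left; rewrite mul1g.
    by right; rewrite mulgA theta_involution mul1g.
  - by exists 1%g s; rewrite ?mul1g // !inE eqxx.
  by exists (theta F) (theta F * s)%g; rewrite ?mulgA ?theta_involution ?mul1g // !inE eqxx orbT.
split.
- by apply/setP=> s; rewrite linear_AutBT -[tau_set]/(T : {set _}) prodP.
- by apply/(@comm_group_setP _ T); apply/commute_sym/normC.
rewrite -[tau_set]/(T : {set _}) TI_cardMg.
  by rewrite card_tau_set mulnC; congr (_ * _)%N; apply: order_theta.
apply/setP=> s; rewrite /= (cycle2g order_theta) !inE; apply/andP/eqP => [[sT]|->].
  by case/orP=> /eqP // s_theta; move: sT; rewrite s_theta (negPf theta_notin_tau_set).
by rewrite eqxx; split=> //; apply: (group1 T).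
Qed.

End BTGeometry.

Theorem theorem4p6 (e q sigma : nat) (e_ge3 : (3 <= e)%N) (e_odd : odd e)
  (q_def : q = (2 ^ e)%N) (sigma_def : sigma = (2 ^ ((e + 1) %/ 2))%N)
  (F : finFieldType) (cardF : #|F| = (q ^ 2)%N)
  (eps delta : F) (eps_notin : eps \notin Fq F q)
  (eps_eq : eps ^+ 2 + eps + delta = 0)
  (delta_in : delta \in Fq F q) (delta_neq1 : delta != 1)
  (tr_delta : \sum_(i < e) delta ^+ (2 ^ i) = 1) :
  [/\ AutBT q sigma eps :&: PGL4 F = (E q sigma eps * <[theta F]>)%g,
      group_set (E q sigma eps * <[theta F]>)%g
    & #|(E q sigma eps * <[theta F]>)%g| = (2 * q ^ 3)%N] /\
  (forall s : {perm point F}, s \in AutBT q sigma eps ->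
     [/\ s (Pinf F) = Pinf F,
         [set s P | P in linf F] = linf F
       & [set s P | P in Piinf F] = Piinf F]).
Proof.
split.
  exact: linear_group_structure e_ge3 e_odd q_def sigma_def cardF eps_notin eps_eq
    delta_in delta_neq1.
move=> s s_aut; have : s \in PGammaL4 F by case/setIP: s_aut.
case/imsetP=> -[phi A] _ /= sE; move: s_aut; rewrite sE => /AutBTP onH_f.
by apply: collineation_fixes_flag e_ge3 e_odd q_def sigma_def cardF eps_notin eps_eq
  delta_in delta_neq1 _ _ onH_f.
Qed.
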